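(* Let $\phi:\mathbb{P}^1\to\mathbb{P}^1$ be a rational map defined over a global function field $K$ of characteristic $p$ with exactly one prime of bad reduction, and let $\mathcal{A}\subseteq\mathbb{P}^1(K)$ be a finite orbit of $\phi$. Then: (i) $\#\mathcal{A}\leqslant3\cdot\#k(\mathfrak p)+6$ for every prime $\mathfrak p$ of good reduction for $\phi$; (ii) if $K$ is an extension of $\mathbb{F}_p(t)$ of degree $D=[K:\mathbb{F}_p(t)]$, then $\#\mathcal{A}\leqslant3p^D+6$.
   Context: A global function field is a finite extension of $\mathbb{F}_p(t)$; its primes are its places, each with valuation ring $R_{\mathfrak p}$, maximal ideal $\mathfrak p$ and residue field $k(\mathfrak p)$. Write $\phi=[F:G]$ with $F,G$ coprime homogeneous over $K$; for a prime $\mathfrak p$ scale so all coefficients lie in $R_{\mathfrak p}$ and not all in $\mathfrak p$; $\phi$ has good reduction at $\mathfrak p$ if the homogeneous resultant $\mathrm{Res}(F,G)$ is a unit of $R_{\mathfrak p}$, bad reduction otherwise. A finite orbit is a forward orbit $\{\phi^i(P):i\geqslant0\}$ that is a finite set. *)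

(* Defs.v *)
From HB Require Import structures.
From mathcomp Require Import all_boot all_order all_algebra all_field.
From mathcomp Require Import fraction.
Set Implicit Arguments. Unset Strict Implicit. Unset Printing Implicit Defensive.
Import Order.TTheory GRing.Theory Num.Theory.
Local Open Scope ring_scope.

Definition FpT (p : nat) : fieldType := {fraction {poly 'F_p}}.

(* A global function field of characteristic p is modelled as a finite
   field extension K of F_p(t) (a fieldExtType over FpT p); its degree
   [K : F_p(t)] is \dim {:K}. *)

Section Places.
Variable K : fieldType.

(* A prime (place) of K, given by its valuation ring R_p: a proper subring
   O of K such that for every nonzero x, x \in O or x^-1 \in O.
   (Every subring contains the prime field F_p.) *)
Definition is_place (O : pred K) : Prop :=
  [/\ 1 \in O,
      (forall x y, x \in O -> y \in O -> x - y \in O),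
      (forall x y, x \in O -> y \in O -> x * y \in O),
      (forall x, x != 0 -> (x \in O) || (x^-1 \in O))
    & exists x, x \notin O].

Definition unitO (O : pred K) (x : K) : bool :=
  [&& x \in O, x != 0 & x^-1 \in O].

Definition in_maxO (O : pred K) (x : K) : bool := (x \in O) && ~~ unitO O x.

Definition residue_card (O : pred K) (N : nat) : Prop :=
  exists s : seq K,
    [/\ size s = N, all (fun x => x \in O) s,
        pairwise (fun x y => ~~ in_maxO O (x - y)) s
      & forall x, x \in O -> exists2 y, y \in s & in_maxO O (x - y)].

(* Homogeneous forms of degree d in X,Y are encoded by their
   dehomogenisations: F(X,Y) = Y^d f(X/Y) with size f <= d+1. *)
Definition hom_form (d : nat) (f : {poly K}) : bool := (size f <= d.+1)%N.

(* F and G coprime: no common non-constant factor.  A common factor of two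
   forms is either Y (both dehomogenisations of degree < d) or comes from a
   common non-constant factor of f and g. *)
Definition hom_coprime (d : nat) (f g : {poly K}) : bool :=
  coprimep f g && ((size f == d.+1) || (size g == d.+1)).

(* Homogeneous resultant Res(F,G) of two forms of degree d (up to sign):
   determinant of the Sylvester matrix of the linear map
   (A,B) |-> A F + B G on forms A,B of degree d-1. *)
Definition hres (d : nat) (f g : {poly K}) : K :=
  \det (\matrix_(i < d + d, j < d + d)
          if (i < d)%N then (if (i <= j)%N then f`_(j - i)%N else 0)
          else (if (i - d <= j)%N then g`_(j - (i - d))%N else 0)).

Definition good_reduction (O : pred K) (d : nat) (f g : {poly K}) : Prop :=
  exists2 c : K, c != 0 &
    [/\ (forall i, (c * f`_i) \in O), (forall i, (c * g`_i) \in O),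
        (exists i, ~~ in_maxO O (c * f`_i) \/ ~~ in_maxO O (c * g`_i))
      & unitO O (hres d (c *: f) (c *: g))].

(* P^1(K) = K u {oo}: Some x is [x:1], None is [1:0]. *)
Definition ratmap (d : nat) (f g : {poly K}) (P : option K) : option K :=
  match P with
  | Some x => if g.[x] != 0 then Some (f.[x] / g.[x]) else None
  | None => if g`_d != 0 then Some (f`_d / g`_d) else None
  end.

End Places.

(* Main.v *)
(** Write S for the bad place.  An element that is a unit at every place
    other than S is constant, i.e. lies in every valuation ring: a
    non-constant x has a place where x is not integral and one where 1/x is
    not integral (Chevalley extension), and these differ.  Constants form a
    field that embeds in every residue field.

    At a good place the map does not decrease the logarithmic chordal
    distance (Sylvester resultant), so distances along an orbit satisfy many
    divisibilities; whenever two of the three products of opposite distances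
    of four orbit points agree at all good places, their cross-ratio is
    constant.  If the cycle length n is odd or divisible by 4, all points of
    the orbit are in this way projectively equivalent to points with constant
    coordinates, so there are at most #k(p) + 1 of them; for n = 2 mod 4 the
    orbit is the union of two orbits of the second iterate, of odd cycle
    length.  Hence the bound 2(#k(p) + 1), which is stronger than (i).  For
    (ii), one of the places above t = 0 and t = 1 is good, and both have
    residue degree at most D. *)
Require Import Defs.
From HB Require Import structures.
From mathcomp Require Import all_boot all_order all_algebra all_field.
From mathcomp Require Import fraction.
From mathcomp Require Import boolp classical_sets.
From mathcomp Require Import ring zify.
Set Implicit Arguments. Unset Strict Implicit. Unset Printing Implicit Defensive.
Import GRing.Theory.
Local Open Scope ring_scope.

(** * Arithmetic of a valuation ring and its maximal ideal *)

Section Place.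
Variables (K : fieldType) (O : pred K).
Hypothesis HO : is_place O.

Lemma place1 : 1 \in O. Proof. by case: HO. Qed.

Lemma placeB x y : x \in O -> y \in O -> x - y \in O.
Proof. by case: HO => _ H _ _ _; apply: H. Qed.

Lemma placeM x y : x \in O -> y \in O -> x * y \in O.
Proof. by case: HO => _ _ H _ _; apply: H. Qed.

Lemma place_total x : x != 0 -> (x \in O) || (x^-1 \in O).
Proof. by case: HO => _ _ _ H _; apply: H. Qed.

Lemma place0 : 0 \in O.
Proof. by rewrite -(subrr 1) placeB ?place1. Qed.

Lemma placeN x : x \in O -> - x \in O.
Proof. by move=> xO; rewrite -sub0r placeB ?place0. Qed.

Lemma placeD x y : x \in O -> y \in O -> x + y \in O.
Proof. by move=> xO yO; rewrite -(opprK y) placeB ?placeN. Qed.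

Lemma placeX x n : x \in O -> x ^+ n \in O.
Proof.
by move=> xO; elim: n => [|n IH]; rewrite ?expr0 ?place1 // exprS placeM.
Qed.

Lemma place_sum (I : Type) (r : seq I) (Q : pred I) (F : I -> K) :
  (forall i, Q i -> F i \in O) -> \sum_(i <- r | Q i) F i \in O.
Proof. by move=> H; apply: (big_ind (fun x => x \in O)) => //; [exact: place0|exact: placeD]. Qed.

Lemma maxOE x : in_maxO O x = (x \in O) && ((x == 0) || (x^-1 \notin O)).
Proof. by rewrite /in_maxO /unitO; case: (x \in O) => //=; rewrite negb_and negbK. Qed.

Lemma maxOW x : in_maxO O x -> x \in O. Proof. by case/andP. Qed.

Lemma maxO0 : in_maxO O 0. Proof. by rewrite maxOE place0 eqxx. Qed.

Lemma maxO1 : in_maxO O 1 = false.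
Proof. by rewrite maxOE invr1 place1 oner_eq0. Qed.

Lemma maxO_unit x : x \in O -> ~~ in_maxO O x -> unitO O x.
Proof. by rewrite /in_maxO => ->; rewrite negbK. Qed.

Lemma maxOM x y : in_maxO O x -> y \in O -> in_maxO O (x * y).
Proof.
rewrite !maxOE => /andP[xO xV] yO; rewrite placeM //=.
have [-> //|x0] /= := eqVneq x 0; first by rewrite mul0r eqxx.
have [-> //|y0] /= := eqVneq y 0; first by rewrite mulr0 eqxx.
rewrite (negPf x0) /= in xV; apply/orP; right; apply: contra xV => xyV.
by rewrite -(mulfK y0 x) invfM invrK mulrC mulrC placeM // mulrC.
Qed.

Lemma maxOMl x y : x \in O -> in_maxO O y -> in_maxO O (x * y).
Proof. by move=> xO yM; rewrite mulrC maxOM. Qed.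

(** Divisibility in [O] is total: when [x / y] lies in [O], the sum is [y] times an element of
    [O]. *)
Lemma maxOD x y : in_maxO O x -> in_maxO O y -> in_maxO O (x + y).
Proof.
wlog: x y / x / y \in O => [W xM yM|xyO xM yM].
  have [->|x0] := eqVneq x 0; first by rewrite add0r.
  have [->|y0] := eqVneq y 0; first by rewrite addr0.
  have /place_total : x / y != 0 by rewrite mulf_neq0 ?invr_eq0.
  case/orP => H; first exact: W.
  by rewrite addrC; apply: W => //; rewrite invfM invrK mulrC in H.
have [y0|y0] := eqVneq y 0; first by rewrite y0 addr0.
have -> : x + y = y * (1 + x / y) by field.
by rewrite maxOM ?placeD ?place1.
Qed.

Lemma maxON x : in_maxO O x -> in_maxO O (- x).
Proof. by move=> xM; rewrite -mulN1r maxOMl // placeN // place1. Qed.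

Lemma maxOB x y : in_maxO O x -> in_maxO O y -> in_maxO O (x - y).
Proof. by move=> xM yM; rewrite maxOD ?maxON. Qed.

Lemma maxO_sum (I : Type) (r : seq I) (Q : pred I) (F : I -> K) :
  (forall i, Q i -> in_maxO O (F i)) -> in_maxO O (\sum_(i <- r | Q i) F i).
Proof. by move=> H; apply: (big_ind (in_maxO O)) => //; [exact: maxO0|exact: maxOD]. Qed.

Lemma maxO_X x n : in_maxO O (x ^+ n) -> x \in O -> in_maxO O x.
Proof.
move=> xM xO; apply: contraT => /(maxO_unit xO) /and3P[_ x0 xV].
by move: xM; rewrite maxOE expf_eq0 (negPf x0) andbF -exprVn (placeX n xV) andbF.
Qed.

Lemma notin_place x : x \notin O -> in_maxO O x^-1.
Proof.
move=> xO; have x0 : x != 0 by apply: contraNneq xO => ->; exact: place0.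
by have := place_total x0; rewrite maxOE invrK xO (negPf xO) orbT andbT.
Qed.

Lemma maxO_notin x : x != 0 -> in_maxO O x -> x^-1 \notin O.
Proof. by rewrite maxOE => /negPf -> /andP[]. Qed.

End Place.

(** * Chevalley extension: valuation rings above a given subring *)

Section Extension.
Variable K : fieldType.
Implicit Types (A : set K) (p q : {poly K}).

Definition is_subring A : Prop :=
  [/\ A 1, forall x y, A x -> A y -> A (x - y)
    & forall x y, A x -> A y -> A (x * y)].

Definition adjoin A (z w : K) : Prop :=
  exists2 q : {poly K}, (forall i, A q`_i) & q.[z] = w.

Section Subring.
Variable A : set K.
Hypothesis HA : is_subring A.

Lemma subring1 : A 1. Proof. by case: HA. Qed.

Lemma subringB x y : A x -> A y -> A (x - y).
Proof. by case: HA => _ H _; apply: H. Qed.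

Lemma subringM x y : A x -> A y -> A (x * y).
Proof. by case: HA => _ _ H; apply: H. Qed.

Lemma subring0 : A 0.
Proof. by rewrite -(subrr 1); apply: subringB; exact: subring1. Qed.

Lemma subringD x y : A x -> A y -> A (x + y).
Proof.
move=> xA yA; rewrite -(opprK y) -(sub0r y); apply: subringB => //.
by apply: subringB => //; exact: subring0.
Qed.

Lemma subringX x n : A x -> A (x ^+ n).
Proof.
move=> xA; elim: n => [|n IH]; rewrite ?expr0; first exact: subring1.
by rewrite exprS; apply: subringM.
Qed.

Lemma subring_sum (I : Type) (r : seq I) (F : I -> K) :
  (forall i, A (F i)) -> A (\sum_(i <- r) F i).
Proof.
by move=> H; apply: (big_ind A) => //; [exact: subring0|exact: subringD].
Qed.

Lemma adjoin_subring z : is_subring (adjoin A z).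
Proof.
split.
- exists 1; last by rewrite hornerC.
  by move=> i; rewrite coef1; case: eqP => _; [exact: subring1|exact: subring0].
- move=> _ _ [p pA <-] [q qA <-]; exists (p - q); last by rewrite !hornerE.
  by move=> i; rewrite coefB; apply: subringB.
- move=> _ _ [p pA <-] [q qA <-]; exists (p * q); last by rewrite hornerM.
  by move=> i; rewrite coefM; apply: subring_sum => j; apply: subringM.
Qed.

Lemma adjoin_sub z w : A w -> adjoin A z w.
Proof.
move=> wA; exists w%:P; last by rewrite hornerC.
by move=> i; rewrite coefC; case: eqP => // _; exact: subring0.
Qed.

Lemma adjoin_gen z : adjoin A z z.
Proof.
exists 'X; last by rewrite hornerX.
by move=> i; rewrite coefX; case: eqP => _; [exact: subring1|exact: subring0].
Qed.

End Subring.

(* Lowering the degree of the longer of two relations [1 = p(z) = q(1/z)]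
   by means of the other one. *)
Lemma no_two_relations A (J : set K) :
    is_subring A ->
    (forall a b, J a -> J b -> J (a + b)) ->
    (forall a b, J a -> A b -> J (a * b)) ->
    (forall a, J a -> A a) -> ~ J 1 -> (forall a, J a -> A (1 - a)^-1) ->
  forall p q z, z != 0 -> (forall i, J p`_i) -> (forall i, J q`_i) ->
    p.[z] = 1 -> q.[z^-1] = 1 -> False.
Proof.
move=> HA JD JM JA J1 JV p q z.
have [k] := ubnP (size p + size q); elim: k => // k IH in p q z *.
wlog: p q z / (size q <= size p)%N => [W ltk z0 pJ qJ pz qz|qp ltk z0 pJ qJ pz qz].
  have [|/ltnW] := leqP (size q) (size p) => H; first exact: (W p q z).
  by apply: (W q p z^-1) => //; rewrite ?invrK ?invr_eq0 // addnC.
have p0 : p != 0 by apply: contra_eqN pz => /eqP->; rewrite horner0 eq_sym oner_eq0.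
case sp: (size p) => [|n] in qp ltk *.
  by move/eqP: sp; rewrite size_poly_eq0 (negPf p0).
have q0 : 1 - q`_0 != 0.
  by apply/eqP => /subr0_eq E; apply: J1; rewrite E.
(* Multiplying q(1/z) = 1 by z^n writes z^n through lower powers of z, as 1 - q_0 is invertible in
   [A]. Substituting this for the top term of [p] gives the shorter relation [p']. *)
pose u := (1 - q`_0)^-1.
pose p' := \poly_(i < n) (p`_i + p`_n * (u * q`_(n - i))).
have uA : A u by exact: JV.
have p'J i : J p'`_i.
  rewrite coef_poly; case: ifP => _; first by apply: JD => //; apply: JM => //; apply: subringM => //; exact: JA.
  rewrite -(mulr0 p`_0); apply: JM => //; exact: subring0.
apply: (IH p' q z) => //.
  by rewrite -ltnS; apply: leq_trans ltk; rewrite ltnS ltn_add2r ltnS size_poly.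
have zn : \sum_(i < n) q`_(n - i) * z ^+ i = (1 - q`_0) * z ^+ n.
  rewrite mulrBl mul1r -[X in X - _](mulr1 (z ^+ n)) -{1}qz.
  rewrite (horner_coef_wide z^-1 qp) mulr_sumr.
  under [in RHS]eq_bigr => i _.
    rewrite exprVn mulrCA -expfB_cond; last by rewrite (negPf z0) add0n -ltnS ltn_ord.
    over.
  rewrite big_ord_recl /= subn0 addrC addKr (reindex_inj rev_ord_inj).
  by apply: eq_bigr => i _ /=; rewrite subKn.
rewrite horner_poly.
under eq_bigr do rewrite mulrDl -!mulrA.
rewrite big_split /= -!mulr_sumr zn /u mulKf //.
by rewrite -pz (@horner_coef_wide _ n.+1) ?sp // big_ord_recr.
Qed.

(** Zorn's lemma gives a subring [B] maximal among those that contain [A] and miss [x^-1].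
    Maximality makes 1 - a invertible in [B] for every a in the ideal x B, and [no_two_relations]
    then forbids that [z] and [z^-1] both lie outside [B]. *)
Lemma place_extension A x : is_subring A -> A x -> ~ A x^-1 ->
  exists O : pred K, [/\ is_place O, forall z, A z -> z \in O & x^-1 \notin O].
Proof.
move=> HA xA xVA.
have x0 : x != 0 by apply: contra_notN xVA => /eqP ->; rewrite invr0; apply: subring0.
pose Q (B : set K) := [/\ is_subring B, (A `<=` B)%classic & ~ B x^-1].
(* The alternative [B = set0] admits chains with empty union; since [A] satisfies [Q], a maximal [B]
   is not empty. *)
have [B [[B0|[HB AB xVB]] Bmax]] :
    exists B, (B = set0 \/ Q B) /\ forall B', (B `<` B')%classic -> ~ (B' = set0 \/ Q B').
- apply: Zorn_bigcup => F FQ Ftot.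
  have FQ' X z : F X -> X z -> Q X.
    by move=> FX Xz; case: (FQ X FX) => // X0; rewrite X0 in Xz.
  have [[X [FX QX]]|NF] := pselect (exists X, F X /\ Q X); last first.
    left; apply/seteqP; split=> // z [X FX Xz]; case: NF; exists X; split=> //.
    exact: FQ' Xz.
  right; case: (QX) => [[X1 _ _] AX XxV].
  have two x1 y1 : (\bigcup_(Y in F) Y)%classic x1 -> (\bigcup_(Y in F) Y)%classic y1 ->
      exists Y, [/\ F Y, Q Y, Y x1 & Y y1].
    move=> [Y FY Yx] [Z FZ Zy].
    case: (Ftot Y Z FY FZ) => S; [exists Z|exists Y]; split=> //; try exact: S.
      exact: FQ' Zy.
    exact: FQ' Yx.
  split; first split.
  + by exists X.
  + move=> x1 y1 H1 H2; have [Y [FY [HY _ _] Y1 Y2]] := two _ _ H1 H2.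
    by exists Y => //; apply: subringB.
  + move=> x1 y1 H1 H2; have [Y [FY [HY _ _] Y1 Y2]] := two _ _ H1 H2.
    by exists Y => //; apply: subringM.
  + by move=> a Aa; exists X => //; apply: AX.
  + by case=> Y FY Yx; case: (FQ' _ _ FY Yx).
- case: (Bmax A); last by right; split.
  by rewrite B0; split=> // S; exact: (S _ (subring1 HA)).
have adj z : ~ B z -> adjoin B z x^-1.
  move=> NBz; apply: contrapT => H; apply: (Bmax (adjoin B z)).
    split; first by move=> w Bw; exact: adjoin_sub.
    by move=> S; apply: NBz; apply: S; exact: adjoin_gen.
  right; split=> //; first exact: adjoin_subring.
  by move=> a Aa; apply: adjoin_sub => //; exact: AB.
(* The ideal x B is proper because [x^-1] is not in [B]; multiplying a relation with value [x^-1] by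
   x gives one with value 1 and coefficients in [J]. *)
pose J : set K := fun w => exists2 b, B b & w = x * b.
have JD a b : J a -> J b -> J (a + b).
  by move=> [a' Ba ->] [b' Bb ->]; exists (a' + b'); rewrite ?mulrDr //; apply: subringD.
have JM a b : J a -> B b -> J (a * b).
  by move=> [a' Ba ->] Bb; exists (a' * b); rewrite ?mulrA //; apply: subringM.
have Bx : B x by exact: AB.
have JB a : J a -> B a by move=> [b Bb ->]; apply: subringM.
have J1 : ~ J 1.
  by move=> [b Bb E]; apply: xVB; rewrite -(mulr1 x^-1) E mulKf.
have JV a : J a -> B (1 - a)^-1.
  (* Otherwise maximality gives x^-1 = q((1 - a)^-1). Multiplying by x (1 - a)^n, with n the size of
     [q], puts (1 - a)^n in [J]; as 1 - (1 - a)^n is also in [J], so is 1. *)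
  move=> Ja; apply: contrapT => /adj [q qB qx].
  have a1 : 1 - a != 0 by apply/eqP => /subr0_eq E; apply: J1; rewrite E.
  pose n := size q; apply: J1.
  have H1 m : J (1 - (1 - a) ^+ m).
    elim: m => [|m IH].
      by exists 0; [exact: subring0|rewrite mulr0 expr0 subrr].
    have -> : 1 - (1 - a) ^+ m.+1 = (1 - (1 - a) ^+ m) + a * (1 - a) ^+ m.
      by rewrite exprS; ring.
    apply: JD => //; apply: JM => //; apply: subringX => //; apply: subringB => //.
      exact: subring1.
    exact: JB.
  rewrite -(subrK ((1 - a) ^+ n) 1); apply: JD => //.
  exists (\sum_(i < n) q`_i * (1 - a) ^+ (n - i)).
    apply: subring_sum => // i; apply: subringM => //; apply: subringX => //.
    by apply: subringB => //; [exact: subring1|exact: JB].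
  rewrite -[LHS](mulVKf x0) -qx horner_coef mulr_suml; congr (_ * _).
  apply: eq_bigr => i _; rewrite -mulrA; congr (_ * _).
  by rewrite exprVn mulrC expfB // ltn_ord.
pose O : pred K := fun z => `[< B z >].
have OP z : reflect (B z) (z \in O) by exact: asboolP.
exists O; split.
- split.
  + by apply/OP; exact: subring1.
  + by move=> z w /OP Bz /OP Bw; apply/OP; apply: subringB.
  + by move=> z w /OP Bz /OP Bw; apply/OP; apply: subringM.
  + move=> z z0; apply: contrapT => /negP; rewrite negb_or.
    case/andP => /OP /adj [p pB pz] /OP /adj [q qB qz].
    have sJ (r : {poly K}) : (forall i, B r`_i) -> forall i, J (x *: r)`_i.
      by move=> rB i; exists r`_i => //; rewrite coefZ.
    apply: (no_two_relations HB JD JM JB J1 JV z0 (sJ _ pB) (sJ _ qB)).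
      by rewrite hornerZ pz divff.
    by rewrite hornerZ qz divff.
  + by exists x^-1; apply/OP.
- by move=> z Az; apply/OP; exact: AB.
- exact/OP.
Qed.

End Extension.

(** * Constants: elements integral at every place *)

Section Constants.
Variables (F K : fieldType) (iota : {rmorphism F -> K}).
Hypothesis iota_place :
  forall (O : pred K) c, is_place O -> iota c \in O.

Definition transcendental (x : K) : Prop :=
  forall q : {poly F}, (map_poly iota q).[x] = 0 -> q = 0.

Definition constant (z : K) : Prop := forall O, is_place O -> z \in O.

Lemma iota_maxO (O : pred K) c : is_place O -> in_maxO O (iota c) = (c == 0).
Proof.
move=> HO; have [->|c0] := eqVneq c 0; first by rewrite rmorph0 maxO0.
by rewrite maxOE fmorph_eq0 (negPf c0) -fmorphV /= !iota_place.
Qed.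

(** Dividing an algebraic equation of degree n by x^n, with 1/x in the maximal ideal, forces the
    leading coefficient into that ideal, although nonzero elements of [F] are units. *)
Lemma transcendental_notin (O : pred K) x :
  is_place O -> x \notin O -> transcendental x.
Proof.
move=> HO xO q qx; apply/eqP; apply: contraT => q0.
have yM := notin_place HO xO.
have x0 : x != 0 by apply: contraNneq xO => ->; exact: place0.
case sq: (size q) => [|n]; first by move/eqP: sq; rewrite size_poly_eq0 (negPf q0).
suff: in_maxO O (iota (lead_coef q)) by rewrite iota_maxO // lead_coef_eq0 (negPf q0).
have : (map_poly iota q).[x] * x ^- n = 0 by rewrite qx mul0r.
rewrite horner_coef size_map_poly sq big_ord_recr /= coef_map mulrDl mulfK ?expf_neq0 //.
rewrite lead_coefE sq addrC => /eqP; rewrite addr_eq0 => /eqP ->.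
apply: maxON => //; rewrite mulr_suml; apply: maxO_sum => // i _.
rewrite coef_map -mulrA; apply: maxOMl => //; first exact: iota_place.
have -> : x ^+ i / x ^+ n = x^-1 ^+ (n - i.+1) * x^-1.
  by rewrite -exprSr subnSK // exprVn expfB // invf_div.
by apply: maxOMl => //; apply: placeX => //; apply: maxOW.
Qed.

(** Place extension is applied to the ring F[x], which does not contain 1/x because x is
    transcendental. *)
Lemma place_above x :
  transcendental x -> exists2 O : pred K, is_place O & x != 0 /\ in_maxO O x.
Proof.
move=> xT.
have x0 : x != 0.
  apply/eqP => E; have /eqP : 'X = 0 :> {poly F} by apply: xT; rewrite map_polyX hornerX.
  by rewrite polyX_eq0.
pose A : set K := fun w => exists q : {poly F}, (map_poly iota q).[x] = w.
have HA : is_subring A.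
  split; first by exists 1; rewrite rmorph1 hornerC.
    by move=> _ _ [p <-] [q <-]; exists (p - q); rewrite rmorphB !hornerE.
  by move=> _ _ [p <-] [q <-]; exists (p * q); rewrite rmorphM !hornerE.
have [||O [HO _ xO]] := @place_extension _ A x HA.
- by exists 'X; rewrite map_polyX hornerX.
- move=> [q qx]; have /eqP : 'X * q - 1 = 0.
    apply: xT; rewrite rmorphB rmorphM rmorph1 /= map_polyX !hornerE qx divff //.
    by rewrite subrr.
  rewrite subr_eq0 => /eqP /(congr1 (fun r => r.[0])).
  by rewrite !hornerE ?mul0r => /eqP; rewrite eq_sym oner_eq0.
by exists O => //; split=> //; rewrite -(invrK x); apply: notin_place.
Qed.

Lemma place_inv (O : pred K) x : is_place O -> x \notin O ->
  exists2 O' : pred K, is_place O' & x^-1 \notin O'.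
Proof.
move=> HO xO; have [O' HO' [x0 xM]] := place_above (transcendental_notin HO xO).
by exists O' => //; apply: maxO_notin.
Qed.

Lemma constantB x y : constant x -> constant y -> constant (x - y).
Proof. by move=> xC yC O HO; apply: placeB => //; [exact: xC|exact: yC]. Qed.

Lemma constantM x y : constant x -> constant y -> constant (x * y).
Proof. by move=> xC yC O HO; apply: placeM => //; [exact: xC|exact: yC]. Qed.

Lemma constant0 : constant 0. Proof. by move=> O; exact: place0. Qed.

Lemma constant1 : constant 1. Proof. by move=> O; exact: place1. Qed.

Lemma constantV x : constant x -> constant x^-1.
Proof.
move=> xC O HO; apply: contraT => xVO.
by have [O' HO'] := place_inv HO xVO; rewrite invrK xC.
Qed.

Lemma constant_maxO (O : pred K) x : is_place O -> constant x -> in_maxO O x -> x = 0.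
Proof.
move=> HO xC xM; apply/eqP; apply: contraT => x0.
by have := maxO_notin x0 xM; rewrite constantV.
Qed.

(** A pole of [x] gives a pole of [x^-1] at some place. Both places must be bad, so they have the
    same valuation ring, which would then contain neither [x] nor [x^-1]. *)
Lemma constant_unit (good : pred K -> Prop) (O0 : pred K) x :
    (forall O, is_place O -> ~ good O -> O =i O0) ->
    (forall O, is_place O -> good O -> x \in O /\ x^-1 \in O) ->
  constant x.
Proof.
move=> bad xU O HO; apply: contraT => xO.
have [O' HO' xO'] := place_inv HO xO.
have NG : ~ good O by move=> /(xU _ HO) [xO1 _]; rewrite xO1 in xO.
have NG' : ~ good O' by move=> /(xU _ HO') [_ xO1]; rewrite xO1 in xO'.
have x0 : x != 0 by apply: contraNneq xO => ->; exact: place0.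
have := place_total HO x0; rewrite (negPf xO) (bad _ HO NG) -(bad _ HO' NG').
by rewrite (negPf xO').
Qed.

(** Distinct constants have distinct residues, because the only constant in a maximal ideal is 0; so
    choosing a representative of each residue is injective on [s]. *)
Lemma constant_card (O : pred K) N (s : seq K) :
    is_place O -> residue_card O N -> uniq s -> (forall x, x \in s -> constant x) ->
  (size s <= N)%N.
Proof.
move=> HO [r [<- rO _ rP]] us sC.
have h x : exists y, x \in s -> y \in r /\ in_maxO O (x - y).
  have [xs|xs] := boolP (x \in s); last by exists 0.
  by have [y yr xy] := rP _ (sC _ xs _ HO); exists y.
have [t tP] := choice h.
rewrite -(size_map t); apply: uniq_leq_size.
  rewrite map_inj_in_uniq // => x y xs ys E.
  apply/eqP; rewrite -subr_eq0; apply/eqP; apply: (constant_maxO HO).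
    by apply: constantB; apply: sC.
  have [[_ Hx] [_ Hy]] := (tP _ xs, tP _ ys).
  have -> : x - y = (x - t x) - (y - t y) by rewrite E; ring.
  exact: maxOB.
by move=> _ /mapP[x xs ->]; case: (tP _ xs).
Qed.

Lemma residue_card_gt0 (O : pred K) N : is_place O -> residue_card O N -> (0 < N)%N.
Proof.
by move=> HO [r [<- _ _ rP]]; case: r rP => // /(_ 0 (place0 HO)) [].
Qed.

End Constants.

(** * Chordal distance on the projective line at one place *)

Section Distance.
Variable K : fieldType.
Implicit Types (O : pred K) (P Q R : option K) (u v w : K * K).

Definition det2 u v : K := u.1 * v.2 - v.1 * u.2.

Definition coords P : K * K := if P is Some x then (x, 1) else (1, 0).

Lemma det2_coords_eq0 P Q : det2 (coords P) (coords Q) = 0 -> P = Q.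
Proof.
case: P Q => [x|] [y|] //=; rewrite /det2 /= ?mulr1 ?mulr0 ?mul1r ?mul0r.
- by move/subr0_eq => ->.
- by move/eqP; rewrite sub0r oppr_eq0 oner_eq0.
- by move/eqP; rewrite subr0 oner_eq0.
Qed.

Definition dvO O (a b : K) : Prop := exists2 c, c \in O & b = a * c.

Definition assocO O (a b : K) : Prop := dvO O a b /\ dvO O b a.

Definition normalized O v : bool :=
  [&& v.1 \in O, v.2 \in O & ~~ (in_maxO O v.1 && in_maxO O v.2)].

(** The scalar that makes the coordinates integral with one of them a unit: for [x] outside [O] it
    replaces [x : 1] by [1 : 1/x]. *)
Definition norm_factor O P : K :=
  if P is Some x then if x \in O then 1 else x^-1 else 1.

Definition norm_coords O P : K * K :=
  (norm_factor O P * (coords P).1, norm_factor O P * (coords P).2).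

(* The ideal generated by [dist O P Q] is the multiplicative form of the
   logarithmic chordal distance at the place O. *)
Definition dist O P Q : K := det2 (norm_coords O P) (norm_coords O Q).

(** Divisibility is an inequality of valuations: the logarithmic distance, large for close points,
    does not decrease under [psi]. *)
Definition noncontracting O (psi : option K -> option K) : Prop :=
  forall P Q, dvO O (dist O P Q) (dist O (psi P) (psi Q)).

Lemma distE O P Q :
  dist O P Q = norm_factor O P * norm_factor O Q * det2 (coords P) (coords Q).
Proof. by rewrite /dist /det2 /=; ring. Qed.

Lemma distC O P Q : dist O P Q = - dist O Q P.
Proof. by rewrite /dist /det2; ring. Qed.

Lemma distPP O P : dist O P P = 0.
Proof. by rewrite /dist /det2 subrr. Qed.

Section AtPlace.
Variable O : pred K.
Hypothesis HO : is_place O.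

Lemma norm_factor_neq0 P : norm_factor O P != 0.
Proof.
case: P => [x|] /=; last exact: oner_neq0.
case: ifPn => [_|xO]; first exact: oner_neq0.
by rewrite invr_eq0; apply: contraNneq xO => ->; exact: place0.
Qed.

Lemma dist_neq0 P Q : P <> Q -> dist O P Q != 0.
Proof.
move=> PQ; rewrite distE !mulf_neq0 ?norm_factor_neq0 //.
by apply/eqP => /det2_coords_eq0.
Qed.

Lemma norm_coordsP P : normalized O (norm_coords O P).
Proof.
rewrite /normalized /norm_coords; case: P => [x|] /=; last first.
  by rewrite mul1r mulr0 place0 ?place1 ?maxO1.
case: ifPn => xO; first by rewrite !mul1r xO place1 //= maxO1 // andbF.
have x0 : x != 0 by apply: contraNneq xO => ->; exact: place0.
by rewrite mulVf // mulr1 place1 //= maxO1 // andbT (maxOW (notin_place HO xO)).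
Qed.

Lemma dvO_refl a : dvO O a a.
Proof. by exists 1; rewrite ?mulr1 ?place1. Qed.

Lemma dvO_trans b a c : dvO O a b -> dvO O b c -> dvO O a c.
Proof.
by move=> [r rO ->] [s sO ->]; exists (r * s); rewrite ?mulrA // placeM.
Qed.

Lemma dvO0 a : dvO O a 0.
Proof. by exists 0; rewrite ?mulr0 ?place0. Qed.

Lemma dvO_mul a b c d : dvO O a b -> dvO O c d -> dvO O (a * c) (b * d).
Proof.
by move=> [r rO ->] [s sO ->]; exists (r * s); [rewrite placeM|ring].
Qed.

Lemma dvO_mulr a b c : dvO O a b -> c \in O -> dvO O a (b * c).
Proof. by move=> [r rO ->] cO; exists (r * c); rewrite ?mulrA // placeM. Qed.

Lemma dvO_add a b c : dvO O a b -> dvO O a c -> dvO O a (b + c).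
Proof.
by move=> [r rO ->] [s sO ->]; exists (r + s); rewrite ?mulrDr // placeD.
Qed.

Lemma dvO_opp a b : dvO O a b -> dvO O a (- b).
Proof. by move=> [r rO ->]; exists (- r); rewrite ?mulrN // placeN. Qed.

Lemma dvO_oppl a b : dvO O a b -> dvO O (- a) b.
Proof. by move=> [r rO ->]; exists (- r); rewrite ?mulrNN // placeN. Qed.

Lemma dvO_sum (I : Type) (r : seq I) (F : I -> K) a :
  (forall i, dvO O a (F i)) -> dvO O a (\sum_(i <- r) F i).
Proof. by move=> H; apply: (big_ind (dvO O a)) => //; [exact: dvO0|exact: dvO_add]. Qed.

Lemma dvO_unit_cancel a b x : unitO O x -> dvO O a (x * b) -> dvO O a b.
Proof.
case/and3P => _ x0 xV H; rewrite -(mulKf x0 b) mulrC.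
exact: dvO_mulr.
Qed.

Lemma assocO_sym a b : assocO O a b -> assocO O b a.
Proof. by case. Qed.

Lemma assocO_trans b a c : assocO O a b -> assocO O b c -> assocO O a c.
Proof. by move=> [ab ba] [bc cb]; split; [apply: dvO_trans bc|apply: dvO_trans ba]. Qed.

Lemma assocO_mul a b c d : assocO O a b -> assocO O c d -> assocO O (a * c) (b * d).
Proof. by move=> [ab ba] [cd dc]; split; apply: dvO_mul. Qed.

Lemma assocO_unit a b : a != 0 -> b != 0 -> assocO O a b ->
  a / b \in O /\ (a / b)^-1 \in O.
Proof.
move=> a0 b0 [[r rO Er] [s sO Es]]; rewrite invf_div; split.
  by rewrite Es mulrC mulKf.
by rewrite Er mulrC mulKf.
Qed.

Lemma dvO_distC t P Q : dvO O t (dist O P Q) -> dvO O t (dist O Q P).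
Proof. by rewrite distC => /dvO_opp; rewrite opprK. Qed.

Lemma dvO_distCl t P Q : dvO O (dist O P Q) t -> dvO O (dist O Q P) t.
Proof. by rewrite distC => /dvO_oppl; rewrite opprK. Qed.

Lemma assocO_distC P Q : assocO O (dist O P Q) (dist O Q P).
Proof. by split; [apply: dvO_distC|apply: dvO_distCl]; exact: dvO_refl. Qed.

Lemma normalized_unit v : normalized O v -> unitO O v.1 \/ unitO O v.2.
Proof.
by case/and3P => v1 v2; rewrite negb_and => /orP[] H; [left|right]; apply: maxO_unit.
Qed.

(** Ultrametric inequality: q_i det(p, r) = det(p, q) r_i + det(q, r) p_i, and some coordinate q_i
    of the middle point is a unit. *)
Lemma dist_triangle t P Q R :
  dvO O t (dist O P Q) -> dvO O t (dist O Q R) -> dvO O t (dist O P R).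
Proof.
rewrite /dist; have /and3P[p1 p2 _] := norm_coordsP P.
have /and3P[r1 r2 _] := norm_coordsP R.
have [qU|qU] := normalized_unit (norm_coordsP Q) => tPQ tQR.
- apply: (dvO_unit_cancel qU).
  have -> : (norm_coords O Q).1 * det2 (norm_coords O P) (norm_coords O R) =
      det2 (norm_coords O P) (norm_coords O Q) * (norm_coords O R).1 +
      det2 (norm_coords O Q) (norm_coords O R) * (norm_coords O P).1.
    by rewrite /det2; ring.
  by apply: dvO_add; apply: dvO_mulr.
- apply: (dvO_unit_cancel qU).
  have -> : (norm_coords O Q).2 * det2 (norm_coords O P) (norm_coords O R) =
      det2 (norm_coords O P) (norm_coords O Q) * (norm_coords O R).2 +
      det2 (norm_coords O Q) (norm_coords O R) * (norm_coords O P).2.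
    by rewrite /det2; ring.
  by apply: dvO_add; apply: dvO_mulr.
Qed.

Lemma noncontracting_iter psi n :
  noncontracting O psi -> noncontracting O (iter n psi).
Proof.
move=> H; elim: n => [|n IH] P Q /=; first exact: dvO_refl.
by apply: dvO_trans (IH P Q) _; exact: H.
Qed.

(** The factor is a ratio of coordinates over a unit coordinate of [w]. If it were in the maximal
    ideal, so would be both coordinates of [v]. *)
Lemma normalized_proportional v w : normalized O v -> normalized O w ->
  det2 v w = 0 -> exists2 u, unitO O u & v = (u * w.1, u * w.2).
Proof.
move=> Nv Nw; rewrite /det2 => /subr0_eq E.
have /and3P[v1 v2 Nm] := Nv.
have unit_ratio x y x' y' : unitO O y -> x' * y = x * y' ->
    x \in O -> x' \in O -> ~~ (in_maxO O x && in_maxO O x') ->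
    y' \in O -> exists2 u, unitO O u & x = u * y /\ x' = u * y'.
  move=> /and3P[yO y0 yV] Exy xO x'O xm y'O; exists (x / y); last first.
    rewrite mulfVK //; split=> //; rewrite mulrAC -Exy; by rewrite mulfK.
  apply: maxO_unit => //; first exact: placeM.
  apply: contra xm => xM.
  have xM' : in_maxO O x by rewrite -(mulfVK y0 x) maxOM.
  have -> : x' = (x / y) * y' by rewrite mulrAC -Exy mulfK.
  by rewrite xM' maxOM.
have /and3P[w1 w2 _] := Nw.
have [wU|wU] := normalized_unit Nw.
  have [|//|//|//|//|u uU [E1 E2]] := unit_ratio v.1 w.1 v.2 w.2 wU.
    by rewrite E mulrC.
  by exists u => //; rewrite -E1 -E2; case: (v).
have [|//|//||//|u uU [E1 E2]] := unit_ratio v.2 w.2 v.1 w.1 wU.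
- by rewrite E mulrC.
- by rewrite andbC.
by exists u => //; rewrite -E1 -E2; case: (v).
Qed.

End AtPlace.

Definition hom_eval (d : nat) (h : {poly K}) v : K :=
  \sum_(i < d.+1) h`_i * (v.1 ^+ i * v.2 ^+ (d - i)).

Section Reduction.
Variables (O : pred K) (d : nat) (f g : {poly K}).
Hypothesis HO : is_place O.
Hypotheses (fO : forall i, f`_i \in O) (gO : forall i, g`_i \in O).

Lemma hom_eval_place (h : {poly K}) v : (forall i, h`_i \in O) -> v.1 \in O -> v.2 \in O ->
  hom_eval d h v \in O.
Proof.
move=> hO v1 v2; apply: place_sum => // i _.
by rewrite !placeM ?placeX.
Qed.

(** The determinant expands over pairs of monomials. Each antisymmetric bracket has a factor (v_1
    w_2)^k - (v_2 w_1)^k up to sign, a multiple of v_1 w_2 - v_2 w_1. *)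
Lemma hom_eval_dv v w : v.1 \in O -> v.2 \in O -> w.1 \in O -> w.2 \in O ->
  dvO O (det2 v w) (det2 (hom_eval d f v, hom_eval d g v)
                         (hom_eval d f w, hom_eval d g w)).
Proof.
move=> v1 v2 w1 w2; pose m u i := u.1 ^+ i * u.2 ^+ (d - i) : K.
have -> : det2 (hom_eval d f v, hom_eval d g v) (hom_eval d f w, hom_eval d g w) =
    \sum_(i < d.+1) \sum_(j < d.+1) (m v i * m w j - m w i * m v j) * (f`_i * g`_j).
  rewrite /det2 /= /hom_eval !mulr_suml -sumrB; apply: eq_bigr => i _.
  rewrite !mulr_sumr -sumrB; apply: eq_bigr => j _; rewrite /m; ring.
apply: dvO_sum => // i; apply: dvO_sum => // j; apply: dvO_mulr => //; last first.
  by rewrite placeM.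
wlog ij : i j / (i <= j)%N => [W|].
  have [/W //|/ltnW/W] := leqP i j.
  move=> /(dvO_opp HO); congr dvO; ring.
have mE u : (m u i = (u.1 ^+ i * u.2 ^+ (d - j)) * u.2 ^+ (j - i)) *
            (m u j = (u.1 ^+ i * u.2 ^+ (d - j)) * u.1 ^+ (j - i)).
  have jd : (j <= d)%N by rewrite -ltnS.
  split; last by rewrite /m mulrAC -exprD subnKC.
  by rewrite /m -mulrA -exprD addnBA // subnK.
pose cc := (v.1 ^+ i * v.2 ^+ (d - j)) * (w.1 ^+ i * w.2 ^+ (d - j)).
have -> : m v i * m w j - m w i * m v j =
    (- (v.1 * w.2) ^+ (j - i) + (v.2 * w.1) ^+ (j - i)) * cc.
  by rewrite !mE /cc !exprMn; ring.
apply: dvO_mulr => //; last by rewrite !placeM ?placeX.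
rewrite addrC subrXX; exists (- \sum_(k < j - i)
    (v.2 * w.1) ^+ ((j - i).-1 - k) * (v.1 * w.2) ^+ k).
  rewrite placeN ?place_sum // => k _.
  by rewrite !placeM ?placeX ?placeM.
by rewrite mulrN -mulNr /det2; congr (_ * _); ring.
Qed.

End Reduction.

End Distance.

(** * The Sylvester matrix and maps with good reduction *)

Section GoodReduction.
Variables (K : fieldType) (O : pred K).
Hypothesis HO : is_place O.

Lemma det_place n (A : 'M[K]_n) : (forall i j, A i j \in O) -> \det A \in O.
Proof.
move=> AO; apply: place_sum => // s _; apply: placeM => //.
  by apply: placeX => //; apply: placeN => //; exact: place1.
by apply: (big_ind (fun x => x \in O)) => //; [exact: place1|move=> *; exact: placeM].
Qed.

Lemma adjugate_place n (A : 'M[K]_n) i j :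
  (forall i j, A i j \in O) -> (\adj A) i j \in O.
Proof.
move=> AO; rewrite mxE; apply: placeM => //.
  by apply: placeX => //; apply: placeN => //; exact: place1.
by apply: det_place => k l; rewrite !mxE.
Qed.

(** Evaluates a Sylvester row on a vector: the row is the coefficient list moved right by [i], and
    the bound on i + d keeps all of it inside the matrix. *)
Lemma shifted_sum (h : {poly K}) (G : nat -> K) i d n :
    (size h <= d.+1)%N -> (i + d < n)%N ->
  \sum_(j < n) (if (i <= j)%N then h`_(j - i) else 0) * G j =
  \sum_(k < d.+1) h`_k * G (i + k)%N.
Proof.
move=> sh lt_n.
rewrite -(big_mkord xpredT (fun j => (if (i <= j)%N then h`_(j - i) else 0) * G j)).
rewrite -(big_mkord xpredT (fun k => h`_k * G (i + k)%N)).
rewrite (@big_cat_nat _ _ _ i) //=; last by lia.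
rewrite big_nat big1 ?add0r; last by move=> j /andP[_ ji]; rewrite leqNgt ji mul0r.
rewrite (@big_cat_nat _ _ _ (d.+1 + i)) //=; [|by lia|by lia].
rewrite [X in _ + X]big_nat [X in _ + X]big1 ?addr0; last first.
  move=> j /andP[dj _]; case: ifP => _; last by rewrite mul0r.
  by rewrite nth_default ?mul0r // (leq_trans sh) //; lia.
rewrite -{1}(add0n i) big_addn addnK; apply: eq_bigr => k _.
by rewrite leq_addl addnK addnC.
Qed.

Variables (d : nat) (f g : {poly K}).
Hypotheses (fO : forall i, f`_i \in O) (gO : forall i, g`_i \in O).
Hypotheses (sf : hom_form d f) (sg : hom_form d g).

(* The Sylvester matrix sends the vector of monomials of degree [2d - 1] to
   multiples of [F] and [G], so its adjugate writes [Res(F, G)] times each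
   monomial as a combination of [F] and [G] over the valuation ring. *)
Lemma hom_eval_normalized v : (0 < d)%N -> unitO O (hres d f g) ->
  normalized O v -> normalized O (hom_eval d f v, hom_eval d g v).
Proof.
move=> d0 resU /and3P[v1 v2 Nm]; rewrite /normalized /= !hom_eval_place //=.
apply: contra Nm => /andP[Fm Gm].
pose M : 'M[K]_(d + d) := \matrix_(i < d + d, j < d + d)
          if (i < d)%N then (if (i <= j)%N then f`_(j - i)%N else 0)
          else (if (i - d <= j)%N then g`_(j - (i - d))%N else 0).
pose G j := v.1 ^+ j * v.2 ^+ ((d + d).-1 - j) : K.
pose V : 'cV[K]_(d + d) := \col_j G j.
have MV i : in_maxO O ((M *m V) i 0).
  rewrite mxE.
  have E (h : {poly K}) k : hom_form d h -> (k < d)%N ->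
      \sum_(j < d + d) (if (k <= j)%N then h`_(j - k) else 0) * G j =
      hom_eval d h v * (v.1 ^+ k * v.2 ^+ (d.-1 - k)).
    move=> hh kd; rewrite (shifted_sum _ hh); last by lia.
    rewrite /hom_eval mulr_suml; apply: eq_bigr => l _; rewrite /G.
    have -> : ((d + d).-1 - (k + l) = (d - l) + (d.-1 - k))%N by have := ltn_ord l; lia.
    by rewrite !exprD; ring.
  under eq_bigr do rewrite !mxE.
  have [id|di] := ltnP i d.
    by rewrite E //; apply: maxOM => //; rewrite placeM ?placeX.
  have kd : (i - d < d)%N by have := ltn_ord i; lia.
  by rewrite E //; apply: maxOM => //; rewrite placeM ?placeX.
have MO i j : M i j \in O.
  by rewrite mxE; do 2 case: ifP => // _; exact: place0.
have VM i : in_maxO O (V i 0).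
  have /and3P[_ r0 rV] := resU.
  have E : \adj M *m (M *m V) = hres d f g *: V.
    by rewrite mulmxA mul_adj_mx mul_scalar_mx.
  have -> : V i 0 = (hres d f g)^-1 * (\adj M *m (M *m V)) i 0.
    by rewrite E [X in _ = _ * X]mxE mulKf.
  apply: maxOMl => //; rewrite mxE; apply: maxO_sum => // j _.
  by apply: maxOMl => //; exact: adjugate_place.
(* The first and last monomials are the pure powers v_2^(2d-1) and v_1^(2d-1), so both coordinates
   land in the maximal ideal. *)
have lt0 : (0 < d + d)%N by lia.
have ltl : ((d + d).-1 < d + d)%N by lia.
have := VM (Ordinal lt0); have := VM (Ordinal ltl); rewrite !mxE /G /= subnn subn0.
by rewrite !expr0 mulr1 mul1r => /(maxO_X HO) -> // /(maxO_X HO) ->.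
Qed.

End GoodReduction.

(** The scaled forms give a lift [Phi] that preserves normalized vectors. Hence [Phi] yields the
    normalized coordinates of the image up to a unit, and [hom_eval_dv] becomes divisibility of
    distances. *)
Lemma good_reduction_noncontracting (K : fieldType) (O : pred K) d (f g : {poly K}) :
    is_place O -> hom_form d f -> hom_form d g -> good_reduction O d f g ->
  noncontracting O (ratmap d f g).
Proof.
move=> HO sf sg [c c0 [cf cg nz res]].
pose f' := c *: f; pose g' := c *: g.
have fO i : f'`_i \in O by rewrite coefZ.
have gO i : g'`_i \in O by rewrite coefZ.
have sf' : hom_form d f' by rewrite /hom_form size_scale.
have sg' : hom_form d g' by rewrite /hom_form size_scale.
pose Phi v := (hom_eval d f' v, hom_eval d g' v).
have PhiN v : normalized O v -> normalized O (Phi v).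
  (* For d = 0 the Sylvester matrix is empty; the forms are then constants, and [nz] keeps one of
     them out of the maximal ideal. *)
  move=> Nv; have [d0|d0] := posnP d; last exact: hom_eval_normalized.
  rewrite /normalized /= !hom_eval_place; try by case/and3P: Nv.
  case: nz => i nz; rewrite /hom_eval /= d0 !big_ord_recl !big_ord0 /=.
  rewrite !addr0 !expr0 !mulr1 negb_and !coefZ.
  have i0 (h : {poly K}) : hom_form d h -> (0 < i)%N -> c * h`_i = 0.
    by rewrite /hom_form d0 => sh i1; rewrite nth_default ?mulr0 // (leq_trans sh).
  have [i1|i1] := posnP i; first by rewrite i1 in nz; apply/orP.
  by move: nz; rewrite !i0 // (maxO0 HO); case.
have PhiE Q : det2 (Phi (norm_coords O Q)) (coords (ratmap d f g Q)) = 0.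
  have [t E] : exists t, Phi (norm_coords O Q) = 
      (t * (if Q is Some x then f.[x] else f`_d), t * (if Q is Some x then g.[x] else g`_d)).
    rewrite /Phi /norm_coords; case: Q => [x|] /=.
      exists (norm_factor O (Some x) ^+ d * c).
      have H (h : {poly K}) : hom_form d h ->
          hom_eval d (c *: h) (norm_factor O (Some x) * x, norm_factor O (Some x) * 1) =
          norm_factor O (Some x) ^+ d * c * h.[x].
        move=> sh; rewrite (horner_coef_wide x sh) mulr_sumr; apply: eq_bigr => i _.
        have := ltn_ord i; case: i => i /= _; rewrite ltnS => /subnKC id.
        by rewrite coefZ mulr1 exprMn -[in RHS]id exprD; ring.
      by rewrite -!H.
    exists c.
    have H (h : {poly K}) : hom_eval d (c *: h) (1 * 1, 1 * 0) = c * h`_d.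
      rewrite /hom_eval /= big_ord_recr /= big1 => [|i _].
        by rewrite subnn mulr1 expr1n coefZ add0r expr0 !mulr1.
      by rewrite mul1r mulr0 expr0n subn_eq0 leqNgt ltn_ord !mulr0.
    by rewrite !H.
  have := PhiN _ (norm_coordsP HO Q); rewrite E /det2 /normalized /=.
  set a := (if Q is Some x then f.[x] else _); set b := (if Q is Some x then g.[x] else _).
  have -> : ratmap d f g Q = if b != 0 then Some (a / b) else None.
    by rewrite /a /b; case: (Q).
  by case: eqVneq => [->|b0] _ /=; [ring|field].
move=> Q R.
have [u /and3P[uO u0 uV] Eu] : exists2 u, unitO O u &
    Phi (norm_coords O Q) = (u * (norm_coords O (ratmap d f g Q)).1,
                            u * (norm_coords O (ratmap d f g Q)).2).
  apply: normalized_proportional => //; [exact/PhiN/norm_coordsP|exact: norm_coordsP|].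
  have := PhiE Q; rewrite /det2 /= => E.
  by rewrite -(mulr0 (norm_factor O (ratmap d f g Q))) -E; ring.
have [w /and3P[wO w0 wV] Ew] : exists2 u, unitO O u &
    Phi (norm_coords O R) = (u * (norm_coords O (ratmap d f g R)).1,
                            u * (norm_coords O (ratmap d f g R)).2).
  apply: normalized_proportional => //; [exact/PhiN/norm_coordsP|exact: norm_coordsP|].
  have := PhiE R; rewrite /det2 /= => E.
  by rewrite -(mulr0 (norm_factor O (ratmap d f g R))) -E; ring.
have -> : dist O (ratmap d f g Q) (ratmap d f g R) =
    det2 (Phi (norm_coords O Q)) (Phi (norm_coords O R)) * (u^-1 * w^-1).
  by rewrite Eu Ew /dist /det2 /=; field; rewrite u0 w0.
apply: dvO_mulr => //; last exact: placeM.
have /and3P[q1 q2 _] := norm_coordsP HO Q; have /and3P[r1 r2 _] := norm_coordsP HO R.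
exact: hom_eval_dv.
Qed.

(** * Points with constant coordinates in a projective frame *)

Section Frame.
Variables (F K : fieldType) (iota : {rmorphism F -> K}).
Hypothesis iota_place :
  forall (O : pred K) c, is_place O -> iota c \in O.
Implicit Types (P Q R S : option K) (v w : K * K).

Definition comb v w (a b : K) : K * K := (a * v.1 + b * w.1, a * v.2 + b * w.2).

(** For independent [v] and [w] these points form the image of the projective line over the
    constants under the projectivity with columns [v] and [w]. *)
Definition in_frame v w P : Prop :=
  exists a b, [/\ constant a, constant b, (a != 0) || (b != 0)
                & det2 (comb v w a b) (coords P) = 0].

Lemma coords_proportional w P : (w.1 != 0) || (w.2 != 0) -> det2 w (coords P) = 0 ->
  exists2 s, s != 0 & w = (s * (coords P).1, s * (coords P).2).
Proof.
case: w => w1 w2; rewrite /det2; case: P => [x|] /= nz.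
  rewrite mulr1 => /subr0_eq E; exists w2; last by rewrite E mulrC mulr1.
  by apply: contraTneq nz => w20; rewrite E w20 mulr0 eqxx.
rewrite mulr0 mul1r sub0r => /eqP; rewrite oppr_eq0 => /eqP E; rewrite E eqxx orbF in nz.
by exists w1 => //; rewrite E mulr1 mulr0.
Qed.

Lemma proportional_inj w P Q : (w.1 != 0) || (w.2 != 0) ->
  det2 w (coords P) = 0 -> det2 w (coords Q) = 0 -> P = Q.
Proof.
move=> nz /(coords_proportional nz) [s s0 Es] /(coords_proportional nz) [t t0 Et].
apply: det2_coords_eq0; apply: (mulfI s0); apply: (mulfI t0).
rewrite !mulr0 -[RHS](_ : det2 w w = 0); last by rewrite /det2 subrr.
by rewrite {1}Es Et /det2 /=; ring.
Qed.

Lemma comb_neq0 v w a b : det2 v w != 0 -> (a != 0) || (b != 0) ->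
  ((comb v w a b).1 != 0) || ((comb v w a b).2 != 0).
Proof.
move=> vw; apply: contraTT; rewrite !negb_or !negbK => /andP[/eqP E1 /eqP E2].
rewrite -(mulrI_eq0 a (mulfI vw)) -(mulrI_eq0 b (mulfI vw)).
have -> : det2 v w * a = (comb v w a b).1 * w.2 - (comb v w a b).2 * w.1.
  by rewrite /det2 /comb /=; ring.
have -> : det2 v w * b = (comb v w a b).2 * v.1 - (comb v w a b).1 * v.2.
  by rewrite /det2 /comb /=; ring.
by rewrite E1 E2 !mul0r subrr eqxx.
Qed.

(** Cramer's identity det(r, q) p + det(p, r) q = det(p, q) r: with the first two vectors scaled by
    these coefficients, the three points get coordinates (1, 0), (0, 1) and (1, 1). *)
Lemma frame_exists P Q R : P <> Q -> P <> R -> Q <> R ->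
  exists v w, [/\ det2 v w != 0, in_frame v w P, in_frame v w Q & in_frame v w R].
Proof.
move=> PQ PR QR.
have D (A B : option K) : A <> B -> det2 (coords A) (coords B) != 0.
  by move=> AB; apply/eqP => /det2_coords_eq0.
pose a := det2 (coords R) (coords Q); pose b := det2 (coords P) (coords R).
have a0 : a != 0 by apply/D/nesym.
have b0 : b != 0 by exact: D.
exists (a * (coords P).1, a * (coords P).2), (b * (coords Q).1, b * (coords Q).2).
split.
- have -> : det2 (a * (coords P).1, a * (coords P).2) (b * (coords Q).1, b * (coords Q).2)
     = a * b * det2 (coords P) (coords Q) by rewrite /det2 /=; ring.
  by rewrite !mulf_neq0 // D.
- exists 1, 0; split; [exact: constant1|exact: constant0|by rewrite oner_eq0|].
  by rewrite /det2 /=; ring.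
- exists 0, 1; split; [exact: constant0|exact: constant1|by rewrite oner_eq0 orbT|].
  by rewrite /det2 /=; ring.
- exists 1, 1; split; [exact: constant1|exact: constant1|by rewrite oner_eq0|].
  by rewrite /det2 /= /a /b /det2; ring.
Qed.

(** The cross-ratio equation is linear in [S], and its solution is det(P, Q) R - lambda det(P, R) Q.
    In frame coordinates these determinants are constants. *)
Lemma in_frame_cross v w P Q R S lambda : det2 v w != 0 ->
    in_frame v w P -> in_frame v w Q -> in_frame v w R -> P <> Q -> Q <> R ->
    constant lambda ->
    det2 (coords P) (coords Q) * det2 (coords R) (coords S) =
    lambda * (det2 (coords P) (coords R) * det2 (coords Q) (coords S)) ->
  in_frame v w S.
Proof.
move=> vw [ap [bp [apC bpC pnz Ep]]] [aq [bq [aqC bqC qnz Eq]]].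
move=> [ar [br [arC brC rnz Er]]] PQ QR lC E.
have [sp sp0 Sp] := coords_proportional (comb_neq0 vw pnz) Ep.
have [sq sq0 Sq] := coords_proportional (comb_neq0 vw qnz) Eq.
have [sr sr0 Sr] := coords_proportional (comb_neq0 vw rnz) Er.
have detE a b a' b' : det2 (comb v w a b) (comb v w a' b') = (a * b' - a' * b) * det2 v w.
  by rewrite /det2 /comb /=; ring.
have detS s t (A B : option K) : det2 (s * (coords A).1, s * (coords A).2)
    (t * (coords B).1, t * (coords B).2) = s * t * det2 (coords A) (coords B).
  by rewrite /det2 /=; ring.
pose x := ap * bq - aq * bp; pose y := lambda * (ap * br - ar * bp).
have x0 : x != 0.
  rewrite -(mulIr_eq0 x (mulIf vw)) -detE Sp Sq detS !mulf_neq0 //.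
  by apply/eqP => /det2_coords_eq0.
have qr0 : aq * br - ar * bq != 0.
  rewrite -(mulIr_eq0 _ (mulIf vw)) -detE Sq Sr detS !mulf_neq0 //.
  by apply/eqP => /det2_coords_eq0.
exists (x * ar - y * aq), (x * br - y * bq).
have xC : constant x by apply: constantB; exact: constantM.
have yC : constant y by apply: constantM => //; apply: constantB; exact: constantM.
split; try by apply: constantB; exact: constantM.
  (* If both coordinates vanished, eliminating [y] would give x det(Q, R) = 0 in frame coordinates,
     although [P], [Q] and [Q], [R] are distinct. *)
  apply: contraT; rewrite negb_or !negbK => /andP[/eqP E1 /eqP E2].
  move: (mulf_neq0 x0 qr0); suff -> : x * (aq * br - ar * bq) =
     aq * (x * br - y * bq) - bq * (x * ar - y * aq) by rewrite E1 E2 !mulr0 subrr eqxx.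
  by ring.
have -> : det2 (comb v w (x * ar - y * aq) (x * br - y * bq)) (coords S) =
   x * det2 (comb v w ar br) (coords S) - y * det2 (comb v w aq bq) (coords S).
  by rewrite /det2 /comb /=; ring.
apply: (mulfI vw); rewrite mulr0.
have -> : det2 v w * (x * det2 (comb v w ar br) (coords S) - y * det2 (comb v w aq bq) (coords S)) =
   (x * det2 v w) * det2 (comb v w ar br) (coords S) -
   lambda * (((ap * br - ar * bp) * det2 v w) * det2 (comb v w aq bq) (coords S)).
  by rewrite /y; ring.
rewrite -!detE Sp Sq Sr !detS.
have H s (A : option K) : det2 (s * (coords A).1, s * (coords A).2) (coords S) =
    s * det2 (coords A) (coords S) by rewrite /det2 /=; ring.
rewrite !H.
have -> : sp * sq * det2 (coords P) (coords Q) * (sr * det2 (coords R) (coords S)) =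
  sp * sq * sr * (det2 (coords P) (coords Q) * det2 (coords R) (coords S)) by ring.
by rewrite E; ring.
Qed.

(** At most one point lies on the line of [v]. Any other is spanned by c v + w with c constant, and
    c determines the point, so [constant_card] applies. *)
Lemma in_frame_card (O : pred K) N v w (s : seq (option K)) :
    is_place O -> residue_card O N -> det2 v w != 0 -> uniq s ->
    (forall P, P \in s -> in_frame v w P) ->
  (size s <= N.+1)%N.
Proof.
move=> HO HN vw us sF.
pose T := [seq P <- s | det2 v (coords P) != 0].
pose c P := - det2 w (coords P) / det2 v (coords P).
have combE a b P : det2 (comb v w a b) (coords P) =
    a * det2 v (coords P) + b * det2 w (coords P).
  by rewrite /det2 /comb /=; ring.
have v0 : (v.1 != 0) || (v.2 != 0).
  apply: contraNT vw; rewrite negb_or !negbK => /andP[/eqP v1 /eqP v2].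
  by rewrite /det2 v1 v2 mul0r mulr0 subrr.
have sT : (size s <= (size T).+1)%N.
  rewrite size_filter -(count_predC (fun P => det2 v (coords P) != 0) s) -addn1 leq_add2l.
  rewrite -size_filter.
  case E: [seq _ <- s | _] => [|P [|Q t]] //.
  have : uniq [seq P <- s | predC (fun P => det2 v (coords P) != 0) P] by exact: filter_uniq.
  have HP : P \in [seq P <- s | predC (fun P => det2 v (coords P) != 0) P].
    by rewrite E inE eqxx.
  have HQ : Q \in [seq P <- s | predC (fun P => det2 v (coords P) != 0) P].
    by rewrite E !inE eqxx orbT.
  move: HP HQ; rewrite !mem_filter /= !negbK => /andP[/eqP DP _] /andP[/eqP DQ _].
  by rewrite E /= (proportional_inj v0 DP DQ) inE eqxx.
apply: leq_trans sT _; rewrite ltnS -(size_map c).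
have cE P : P \in T -> det2 (comb v w (c P) 1) (coords P) = 0.
  by rewrite mem_filter => /andP[D _]; rewrite combE /c; field.
apply: (constant_card iota_place HO HN).
  rewrite map_inj_in_uniq ?filter_uniq // => P Q PT QT EPQ.
  have := cE _ QT; rewrite -EPQ; apply: proportional_inj (cE _ PT).
  by apply: comb_neq0 => //; rewrite oner_eq0 orbT.
move=> _ /mapP[P PT ->]; move: (PT); rewrite mem_filter => /andP[D Ps].
have [a [b [aC bC ab E]]] := sF _ Ps.
have b0 : b != 0.
  apply: contraTneq ab => b0; move: E; rewrite combE b0 mul0r addr0 eqxx orbF => /eqP.
  by rewrite mulf_eq0 (negPf D) orbF negbK.
suff -> : c P = a / b by apply: constantM => //; exact: (constantV iota_place).
apply/eqP; rewrite /c eqr_div //; apply/eqP.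
by move: E; rewrite combE => /eqP; rewrite addr_eq0 => /eqP ->; ring.
Qed.

Variables (good : pred K -> Prop) (O0 : pred K).
Hypothesis bad_unique : forall O, is_place O -> ~ good O -> O =i O0.

(* At all good places the two products agree up to units, so the cross-ratio
   of the four points is a unit away from one place, hence constant. *)
Lemma in_frame_assoc v w P Q R S : det2 v w != 0 ->
    in_frame v w P -> in_frame v w Q -> in_frame v w R ->
    P <> Q -> P <> R -> Q <> R ->
    (forall O, is_place O -> good O ->
       assocO O (dist O P Q * dist O R S) (dist O P R * dist O Q S)) ->
  in_frame v w S.
Proof.
move=> vw Pf Qf Rf PQ PR QR H.
(* If [S] is [R] or [Q] there is nothing to prove; otherwise the denominator [m] of the cross-ratio
   is nonzero. *)
have [<- //|/eqP RS] := eqVneq R S.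
have [<- //|/eqP QS] := eqVneq Q S.
have D (A B : option K) : A <> B -> det2 (coords A) (coords B) != 0.
  by move=> AB; apply/eqP => /det2_coords_eq0.
pose n := det2 (coords P) (coords Q) * det2 (coords R) (coords S).
pose m := det2 (coords P) (coords R) * det2 (coords Q) (coords S).
have m0 : m != 0 by rewrite mulf_neq0 ?D.
apply: (@in_frame_cross v w P Q R S (n / m)) => //; last by rewrite -/m mulfVK.
apply: (constant_unit iota_place bad_unique) => O HO gO.
(* Each point occurs once above and once below, so the normalizing factors cancel. *)
have -> : n / m = (dist O P Q * dist O R S) / (dist O P R * dist O Q S).
  have [p q r s] := And4 (norm_factor_neq0 HO P) (norm_factor_neq0 HO Q)
    (norm_factor_neq0 HO R) (norm_factor_neq0 HO S).
  by rewrite !distE /n /m; field; rewrite !D // p q r s.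
by apply: assocO_unit; rewrite ?mulf_neq0 ?dist_neq0 //; exact: H.
Qed.

End Frame.

(** * Distances along an orbit and frames containing it *)

Section Orbit.
Variables (F K : fieldType) (iota : {rmorphism F -> K}).
Hypothesis iota_place :
  forall (O : pred K) c, is_place O -> iota c \in O.
Variables (good : pred K -> Prop) (O0 : pred K).
Hypothesis bad_unique : forall O, is_place O -> ~ good O -> O =i O0.
Variable psi : option K -> option K.
Hypothesis psi_nc : forall O, is_place O -> good O -> noncontracting O psi.
Variable P0 : option K.

Definition orb (i : nat) : option K := iter i psi P0.

Lemma dist_shift (O : pred K) i j k : is_place O -> good O ->
  dvO O (dist O (orb i) (orb j)) (dist O (orb (i + k)) (orb (j + k))).
Proof.
move=> HO gO; rewrite /orb ![(_ + k)%N]addnC !iterD.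
exact: noncontracting_iter (psi_nc HO gO) _ _.
Qed.

(** The k steps of length [u] are shifts of the first one, so its distance divides each of theirs;
    the ultrametric inequality adds them up. *)
Lemma dist_multiple (O : pred K) i u k : is_place O -> good O ->
  dvO O (dist O (orb i) (orb (i + u))) (dist O (orb i) (orb (i + u * k))).
Proof.
move=> HO gO; elim: k => [|k IH].
  by rewrite muln0 addn0 distPP; exact: dvO0.
apply: (dist_triangle HO IH); rewrite mulnS addnCA [(u + _)%N]addnC.
have -> : (i + u * k + u = i + u + u * k)%N by lia.
exact: dist_shift.
Qed.

(** * Orbits that end in a fixed point *)

Section FixedPoint.
Variable m : nat.
Hypothesis orb_fix : orb m.+1 = orb m.

Lemma orb_const i : (m <= i)%N -> orb i = orb m.
Proof.
elim: i => [|i IH]; first by rewrite leqn0 => /eqP ->.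
by rewrite leq_eqVlt => /predU1P[<- //|/IH E]; rewrite /orb iterS -/(orb i) E.
Qed.

(** Repeating the step j - i from [i] reaches the fixed point, which gives one divisibility.
    Shifting the pair (i, m) by j - i gives that of the distance from j to m, and the triangle
    inequality gives the other. *)
Lemma dist_fixed (O : pred K) i j : is_place O -> good O -> (i < j)%N ->
  assocO O (dist O (orb i) (orb j)) (dist O (orb i) (orb m)).
Proof.
move=> HO gO ij; have E : (i + (j - i) = j)%N by lia.
split.
  have := dist_multiple i (j - i) m HO gO; rewrite E [orb (_ + _)]orb_const //.
  by rewrite (leq_trans _ (leq_addl _ _)) // leq_pmull // subn_gt0.
apply: (dist_triangle HO (dvO_refl HO _)); apply: (dvO_distC HO).
have := dist_shift i m (j - i) HO gO; rewrite E [orb (m + _)]orb_const //.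
exact: leq_addr.
Qed.

End FixedPoint.

(** * Orbits that end in a cycle of length [n] *)

Section Cycle.
Variables (m n : nat).
Hypotheses (n_gt0 : (0 < n)%N) (orb_per : orb (m + n) = orb m).
Hypothesis orb_min : forall u, (0 < u < n)%N -> orb (m + u) <> orb m.

Definition cyc (i : nat) : option K := orb (m + i).

Lemma cyc_mod i j : i = j %[mod n] -> cyc i = cyc j.
Proof.
have H k : cyc k = cyc (k %% n).
  rewrite {1}(divn_eq k n); elim: (k %/ n)%N => [|q IH] //.
  rewrite -IH /cyc mulSn; have -> : (m + (n + q * n + k %% n) = (q * n + k %% n) + (m + n))%N by lia.
  by rewrite /orb iterD -/(orb (m + n)) orb_per -iterD addnC.
by rewrite (H i) (H j) => ->.
Qed.

Lemma cyc_addM i k : cyc (i + k * n) = cyc i.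
Proof. by apply: cyc_mod; rewrite addnC modnMDl. Qed.

Lemma cyc_neq i u : ~~ (n %| u)%N -> cyc i <> cyc (i + u).
Proof.
(* Another i (n - 1) iterations move index i to i n, which names the same point as index 0. *)
move=> nu E; have : cyc (i * n) = cyc (u + i * n).
  have -> : (i * n = i * n.-1 + i)%N by rewrite -mulnSr prednK.
  have -> : (u + (i * n.-1 + i) = i * n.-1 + (i + u))%N by lia.
  have cE a k : cyc (a + k) = iter a psi (cyc k) by rewrite /cyc addnCA /orb iterD.
  by rewrite (cE _ i) E -cE.
rewrite cyc_addM -[X in cyc X = _]add0n cyc_addM => E'.
apply: (@orb_min (u %% n)); first by rewrite ltn_mod n_gt0 lt0n andbT.
have := @cyc_mod (u %% n) u (modn_mod u n).
by rewrite -E' /cyc addn0.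
Qed.

(** A shift by k is undone by a further shift by k (n - 1), so divisibility holds in both
    directions. *)
Lemma dist_cyc_shift (O : pred K) i j k : is_place O -> good O ->
  assocO O (dist O (cyc i) (cyc j)) (dist O (cyc (i + k)) (cyc (j + k))).
Proof.
move=> HO gO; rewrite /cyc !addnA; split; first exact: dist_shift.
have := dist_shift (m + i + k) (m + j + k) (k * n.-1) HO gO.
by rewrite -!addnA -!mulnS prednK // -!/(cyc _) !cyc_addM.
Qed.

Lemma dist_cyc1_dv (O : pred K) i j : is_place O -> good O ->
  dvO O (dist O (cyc 0) (cyc 1)) (dist O (cyc i) (cyc j)).
Proof.
move=> HO gO.
have H k l : dvO O (dist O (cyc 0) (cyc 1)) (dist O (cyc k) (cyc (k + l))).
  have [H1 _] := dist_cyc_shift 0 1 k HO gO; apply: (dvO_trans HO H1).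
  have H2 := dist_multiple (m + k) 1 l HO gO.
  by rewrite mul1n -!addnA -!/(cyc _) [(k + 1)%N]addnC in H2.
have [ij|/ltnW ji] := leqP i j; first by rewrite -(subnKC ij).
by apply: dvO_distC => //; rewrite -(subnKC ji).
Qed.

Definition adjacent (i j : nat) : Prop := forall O : pred K, is_place O -> good O ->
  assocO O (dist O (cyc i) (cyc j)) (dist O (cyc 0) (cyc 1)).

Lemma adjacent_sym i j : adjacent i j -> adjacent j i.
Proof.
move=> H O HO gO; apply: (assocO_trans HO) (H O HO gO).
exact: assocO_distC.
Qed.

(** Bezout gives a with n dividing 1 + a u. From index i + 1, a steps of length u thus lead back to
    the point of index i, so a step of length u divides a step of length 1. *)
Lemma adjacent_coprime i u : coprime u n -> adjacent i (i + u).
Proof.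
move=> un O HO gO; split; last exact: dist_cyc1_dv.
have [a _] := Bezoutl u n_gt0.
rewrite gcdnC (eqP un) => /dvdnP[q Eq].
have [H1 _] := dist_cyc_shift i (i + u) 1 HO gO.
apply: (dvO_trans HO H1).
have := dist_multiple (m + (i + 1)) u a HO gO.
have -> : (m + (i + 1) + u = m + (i + u + 1))%N by lia.
have -> : (m + (i + 1) + u * a = m + (i + q * n))%N by rewrite -Eq; lia.
rewrite -!/(cyc _) cyc_addM => H2; apply: (dvO_trans HO H2).
apply: (dvO_distCl HO).
have [_] := dist_cyc_shift 0 1 i HO gO.
by rewrite add0n addnC.
Qed.

Lemma adjacent1 i : adjacent i (i + 1).
Proof. by apply: adjacent_coprime; exact: coprime1n. Qed.

(** The four sides ij, jl, lk, ki of the quadrilateral have the same length at every good place, so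
    both products of opposite sides equal its square up to a unit. *)
Lemma in_frame_square v w i j k l : det2 v w != 0 ->
    in_frame v w (cyc i) -> in_frame v w (cyc j) -> in_frame v w (cyc k) ->
    cyc i <> cyc j -> cyc i <> cyc k -> cyc j <> cyc k ->
    adjacent i j -> adjacent k l -> adjacent i k -> adjacent j l ->
  in_frame v w (cyc l).
Proof.
move=> vw fi fj fk ij ik jk Aij Akl Aik Ajl.
apply: (in_frame_assoc iota_place bad_unique vw fi fj fk) => // O HO gO.
by apply: assocO_mul => //; apply: assocO_trans (assocO_sym _) => //;
  [exact: Aij|exact: Aik|exact: Akl|exact: Ajl].
Qed.

Hypothesis n_gt2 : (2 < n)%N.

Let nd1 : ~~ (n %| 1)%N. Proof. by rewrite dvdn1; lia. Qed.

Lemma cycle_frame : exists v w, [/\ det2 v w != 0, in_frame v w (cyc 0),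
  in_frame v w (cyc 1) & in_frame v w (cyc 2)].
Proof.
have nd2 : ~~ (n %| 2)%N by rewrite gtnNdvd.
apply: frame_exists; first exact: (cyc_neq (i := 0) nd1).
  exact: (cyc_neq (i := 0) nd2).
exact: (cyc_neq (i := 1) nd1).
Qed.

(** For odd n the steps 1 and 2 are both prime to n, so i, i + 1 and i + 2 determine i + 3 through a
    quadrilateral with sides 1, 2, 1, 2. *)
Lemma odd_cycle_in_frame v w : det2 v w != 0 -> odd n ->
    in_frame v w (cyc 0) -> in_frame v w (cyc 1) -> in_frame v w (cyc 2) ->
  forall i, in_frame v w (cyc i).
Proof.
move=> vw on f0 f1 f2 i.
have nd2 : ~~ (n %| 2)%N by rewrite gtnNdvd.
have c2 : coprime 2 n by rewrite coprime2n.
suff: [/\ in_frame v w (cyc i), in_frame v w (cyc (i + 1)) & in_frame v w (cyc (i + 2))] by case.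
elim: i => [|i [fi fi1 fi2]] //.
have E1 : (i.+1 + 1 = i + 2)%N by lia.
have E2 : (i.+1 + 2 = i + 3)%N by lia.
rewrite E1 E2 -[i.+1]addn1; split=> //.
have E3 : (i + 3 = i + 2 + 1)%N by lia.
have E4 : (i + 3 = i + 1 + 2)%N by lia.
have E5 : (i + 2 = i + 1 + 1)%N by lia.
apply: (in_frame_square vw fi fi1 fi2); try exact: cyc_neq.
- by rewrite E5; exact: cyc_neq.
- exact: adjacent1.
- by rewrite E3; exact: adjacent1.
- exact: adjacent_coprime.
- by rewrite E4; exact: adjacent_coprime.
Qed.

(* When 4 divides n, the differences 1 and r - 1, r + 1 with r = n/2 are
   units modulo n. *)
Lemma four_cycle_in_frame v w : det2 v w != 0 -> (4 %| n)%N ->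
    in_frame v w (cyc 0) -> in_frame v w (cyc 1) -> in_frame v w (cyc 2) ->
  forall i, in_frame v w (cyc i).
Proof.
move=> vw n4 f0 f1 f2.
have [r [En r1 re]] : exists r, [/\ n = r * 2, 1 < r & odd r = false]%N.
  by case/dvdnP: n4 => q En; exists (q * 2)%N; rewrite oddM andbF; split=> //; lia.
have cr1 : coprime (r + 1) n.
  by rewrite En coprimeMr addn1 coprimeSn coprimen2 /= re.
have cr2 : coprime (r - 1) n.
  by rewrite En coprimeMr subn1 coprimePn ?coprimen2; lia.
have ndr : ~~ (n %| r)%N by rewrite gtnNdvd; lia.
have ndr1 : ~~ (n %| r + 1)%N by rewrite gtnNdvd; lia.
have ndr2 : ~~ (n %| r - 1)%N by rewrite gtnNdvd; lia.
have nd2 : ~~ (n %| 2)%N by rewrite gtnNdvd.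
have A i j u : coprime u n -> (j = i + u \/ i = j + u)%N -> adjacent i j.
  move=> cu [] ->; first exact: adjacent_coprime.
  exact/adjacent_sym/adjacent_coprime.
have D i j u : ~~ (n %| u)%N -> (j = i + u \/ i = j + u)%N -> cyc i <> cyc j.
  by move=> nu [] ->; [exact: cyc_neq|apply: nesym; exact: cyc_neq].
have c1 := coprime1n n.
(* The point opposite index 1 starts the induction, which carries along j, j + r and j + 1: these
   give j + 1 + r, and then j + 2. *)
have fr : in_frame v w (cyc (1 + r)).
  apply: (in_frame_square vw f1 f2 f0).
  - by apply: (D _ _ 1)%N => //; lia.
  - by apply: (D _ _ 1)%N => //; lia.
  - by apply: (D _ _ 2)%N => //; lia.
  - by apply: (A _ _ 1)%N => //; lia.
  - by apply: (A _ _ (r + 1))%N => //; lia.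
  - by apply: (A _ _ 1)%N => //; lia.
  - by apply: (A _ _ (r - 1))%N => //; lia.
have H j : [/\ in_frame v w (cyc j.+1), in_frame v w (cyc (j.+1 + r))
             & in_frame v w (cyc (j.+1 + 1))].
  elim: j => [|j [fj fjr fj1]]; first by [].
  move: (j.+1) fj fjr fj1 => {}j fj fjr fj1.
  have fj1r : in_frame v w (cyc (j.+1 + r)).
    apply: (in_frame_square vw fj1 fj fjr).
    - by apply: (D _ _ 1)%N => //; lia.
    - by apply: (D _ _ (r - 1))%N => //; lia.
    - by apply: (D _ _ r)%N => //; lia.
    - by apply: (A _ _ 1)%N => //; lia.
    - by apply: (A _ _ 1)%N => //; lia.
    - by apply: (A _ _ (r - 1))%N => //; lia.
    - by apply: (A _ _ (r + 1))%N => //; lia.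
  split=> //; first by rewrite -addn1.
  apply: (in_frame_square vw fj fj1 fj1r).
  - by apply: (D _ _ 1)%N => //; lia.
  - by apply: (D _ _ (r + 1))%N => //; lia.
  - by apply: (D _ _ r)%N => //; lia.
  - by apply: (A _ _ 1)%N => //; lia.
  - by apply: (A _ _ (r - 1))%N => //; lia.
  - by apply: (A _ _ (r + 1))%N => //; lia.
  - by apply: (A _ _ 1)%N => //; lia.
case=> [|i]; last by case: (H i).
by rewrite -(cyc_addM 0 1) mul1n add0n -(prednK n_gt0); case: (H n.-1).
Qed.

(* A point [b] steps before the cycle is equidistant from the two neighbours
   of the cycle point that has the same image under the [b]-th iterate. *)
Lemma tail_in_frame v w : det2 v w != 0 -> (forall i, in_frame v w (cyc i)) ->
  forall j, in_frame v w (orb j).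
Proof.
move=> vw fc j; have [mj|/ltnW jm] := leqP m j.
  by rewrite -(subnKC mj); exact: fc.
(* The choice of [i] makes i + b a multiple of n, so b iterations send both [cyc i] and [orb j] to
   [orb m]. *)
pose b := (m - j)%N; pose i := (b * n.-1)%N.
have bn : (b * n.-1 + b = b * n)%N by rewrite -mulnSr prednK.
have nd2 : ~~ (n %| n - 2)%N by rewrite gtnNdvd; lia.
have cn1 : coprime (n - 1) n.
  by rewrite subn1 coprimePn.
have nn1 : ~~ (n %| n - 1)%N by rewrite gtnNdvd; lia.
apply: (in_frame_assoc iota_place bad_unique vw (fc i) (fc (i + 1)%N) (fc (i + (n - 1))%N)).
- exact: cyc_neq.
- exact: cyc_neq.
- by have -> : (i + (n - 1) = i + 1 + (n - 2))%N; [lia|exact: cyc_neq].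
move=> O HO gO; apply: assocO_mul => //.
  apply: assocO_trans (assocO_sym _) => //; last exact: adjacent_coprime.
  exact: adjacent1.
(* After b iterations the pair becomes indices k and 0 on the cycle, at the smallest distance d
   there; so the distance from i + k to j divides d, hence that from i + k to i + l, and the
   triangle inequality applies. *)
have near k l : adjacent 0 k -> dvO O (dist O (cyc (i + k)) (orb j)) (dist O (cyc (i + l)) (orb j)).
  move=> Ak; apply: (dvO_distC HO); apply: dist_triangle => //.
    by apply: (dvO_distC HO); exact: dvO_refl.
  apply: (dvO_trans HO) (dist_cyc1_dv _ _ HO gO).
  have := dist_shift (m + (i + k)) j b HO gO.
  have -> : (j + b = m + 0)%N by rewrite /b; lia.
  have -> : (m + (i + k) + b = m + (k + b * n))%N by rewrite -bn /i; lia.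
  rewrite -!/(cyc _) cyc_addM => H; apply: (dvO_trans HO H).
  by apply: (dvO_distCl HO); case: (Ak O HO gO).
split; apply: near; first exact: (adjacent_coprime 0 cn1).
exact: (adjacent1 0).
Qed.

End Cycle.

(** The whole orbit lies in one frame, built from three points of the cycle, or from the last three
    points of the orbit when the cycle is a fixed point; [in_frame_card] then counts. *)
Theorem orbit_card (O : pred K) N m n (s : seq (option K)) :
    is_place O -> residue_card O N ->
    (0 < n)%N -> orb (m + n) = orb m ->
    (forall u, (0 < u < n)%N -> orb (m + u) <> orb m) ->
    odd n || (4 %| n)%N ->
    uniq s -> (forall P, P \in s -> exists i, P = orb i) ->
  (size s <= N.+1)%N.
Proof.
move=> HO HN n0 per mini n24 us sorb.
have card v w : det2 v w != 0 -> (forall j, in_frame v w (orb j)) -> (size s <= N.+1)%N.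
  move=> vw fr; apply: (in_frame_card iota_place HO HN vw us) => P /sorb [i ->].
  exact: fr.
have [n1|n1] := leqP n 1.
  have {n1} n1 : n = 1%N by lia.
  have ex : exists k, orb k.+1 == orb k.
    by exists m; rewrite -addn1 -n1 per.
  case: (ex_minnP ex) => k /eqP kfix kmin.
  have kneq i : (i < k)%N -> orb i.+1 <> orb i.
    by move=> ik /eqP /kmin; rewrite leqNgt ik.
  have [k2|k2] := ltnP k 2.
    (* Here the orbit has at most two points, and N is at least 1. *)
    have N0 := residue_card_gt0 HO HN.
    apply: (@leq_trans (size [:: orb 0; orb 1])) => //; apply: uniq_leq_size => // P /sorb [i ->].
    have [i2|i2] := ltnP i 2; first by case: i i2 => [|[|]] //; rewrite !inE eqxx ?orbT.
    rewrite (orb_const kfix); last by lia.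
    by case: k k2 {kfix kmin kneq} => [|[|]] //; rewrite !inE eqxx ?orbT.
  have [l Ek] : exists l, k = l.+2 by exists k.-2; lia.
  rewrite {}Ek in kfix kneq.
  have n1' : orb l.+1 <> orb l by apply: kneq; lia.
  have n2' : orb l.+2 <> orb l.+1 by apply: kneq; lia.
  have n3' : orb l.+2 <> orb l.
    by move=> E; apply: n2'; rewrite -kfix {1}/orb iterS -/(orb l.+2) E.
  have [v [w [vw f0 f1 f2]]] := frame_exists (nesym n1') (nesym n3') (nesym n2').
  apply: (card v w vw) => j.
  have [jl|lj] := ltnP j l; last first.
    have [->|] := eqVneq j l; first exact: f0.
    have [->|] := eqVneq j l.+1; first by move=> _; exact: f1.
    by move=> jl1 jl0; rewrite (orb_const kfix) //; lia.
  (* By [dist_fixed] an earlier point is equidistant from all later ones: l from l + 1 and l + 2,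
     and j likewise. *)
  apply: (in_frame_assoc iota_place bad_unique vw f0 f1 f2); try exact: nesym.
  move=> O' HO' gO'; apply: assocO_mul => //; first exact: (dist_fixed kfix).
  have D P Q := assocO_distC HO' P Q.
  apply: (assocO_trans HO') (D _ _); apply: (assocO_trans HO') (D _ _) _.
  apply: assocO_sym; apply: (dist_fixed kfix) => //; lia.
have n2 : (2 < n)%N.
  by case: n n1 n24 {n0 per mini} => [|[|[|]]].
have [v [w [vw f0 f1 f2]]] := cycle_frame n0 per mini n2.
apply: (card v w vw); apply: (tail_in_frame n0 per) => //.
case/orP: n24 => Hn; first exact: (odd_cycle_in_frame n0 per mini).
exact: (four_cycle_in_frame n0 per mini).
Qed.

End Orbit.

(** * Reduced fractions and elements of least valuation *)

Lemma fraction_coprime (F : fieldType) (z : {fraction {poly F}}) :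
  exists a b : {poly F}, [/\ b != 0, coprimep a b & z = tofrac a / tofrac b].
Proof.
have [a [b [b0 ->]]] : exists a b : {poly F}, b != 0 /\ z = tofrac a / tofrac b.
  elim/quotW: z => r; exists r.1, r.2; split; first exact: denom_ratioP.
  have d0 : tofrac r.2 != 0 by rewrite tofrac_eq0 denom_ratioP.
  apply: (mulIf d0); rewrite mulfVK //; unlock tofrac; rewrite -[LHS]FracField.pi_mul.
  apply/eqmodP; rewrite /= FracField.equivfE /FracField.mulf !numden_Ratio ?mulr1 ?oner_eq0 ?denom_ratioP //.
  by rewrite mulrC.
pose h := gcdp a b.
have h0 : h != 0 by rewrite gcdp_eq0 negb_and b0 orbT.
have Eb : b = b %/ h * h by rewrite divpK // dvdp_gcdr.
exists (a %/ h), (b %/ h); split.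
- by apply: contraNneq b0 => E; rewrite Eb E mul0r.
- by apply: coprimep_div_gcd; rewrite b0 orbT.
rewrite {1}Eb -{1}[a](divpK (dvdp_gcdl a b)) !tofracM -/h -mulf_div divff ?mulr1 //.
by rewrite tofrac_eq0.
Qed.

(** Finds an entry of least valuation; dividing a linear relation by such a coefficient makes it
    integral and still nonzero modulo the maximal ideal. *)
Lemma place_dominant (K : fieldType) (O : pred K) (s : seq K) x :
  is_place O -> x \in s -> x != 0 ->
  exists z, [/\ z \in s, z != 0 & forall w, w \in s -> w / z \in O].
Proof.
move=> HO; elim: s x => // y s IH x; rewrite inE => xs x0.
have [/hasP[t ts t0]|] := boolP (has (fun t => t != 0) s); last first.
  move=> /hasPn s0; exists y.
  have Exy : x = y by case/predU1P: xs => // /s0; rewrite x0.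
  rewrite -Exy inE eqxx; split=> // w; rewrite inE => /predU1P[->|/s0].
    by rewrite divff // place1.
  by rewrite negbK => /eqP ->; rewrite mul0r place0.
have [z [zs z0 zP]] := IH t ts t0.
have [yz|yz] := boolP (y / z \in O).
  by exists z; rewrite inE zs orbT; split=> // w; rewrite inE => /predU1P[->|/zP].
have y0 : y != 0 by apply: contraNneq yz => ->; rewrite mul0r place0.
have zy : z / y \in O by rewrite -invf_div (maxOW (notin_place HO yz)).
exists y; rewrite inE eqxx; split=> // w; rewrite inE => /predU1P[->|/zP wz].
  by rewrite divff // place1.
have -> : w / y = w / z * (z / y) by field; rewrite y0 z0.
exact: placeM.
Qed.

(** * Residue fields above the rational places t = c *)

Section FunctionField.
Variables (p : nat) (K : fieldExtType (FpT p)).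
Hypothesis p_prime : prime p.

Definition poly_embed : {rmorphism {poly 'F_p} -> K} :=
  in_alg K \o @tofrac {poly 'F_p}.

Definition prime_embed : {rmorphism 'F_p -> K} := poly_embed \o polyC.

Lemma prime_embed_place (O : pred K) c : is_place O -> prime_embed c \in O.
Proof.
move=> HO; rewrite -(natr_Zp c) rmorph_nat.
by elim: (nat_of_ord c) => [|k IH]; [exact: place0|rewrite -natr1; apply: placeD => //; exact: place1].
Qed.

Lemma map_poly_embed (q r : {poly 'F_p}) :
  (map_poly prime_embed q).[poly_embed r] = poly_embed (q \Po r).
Proof.
rewrite horner_coef size_map_poly comp_polyE rmorph_sum; apply: eq_bigr => i _.
by rewrite coef_map -mul_polyC rmorphM rmorphXn.
Qed.

Lemma poly_embed_eq0 (q : {poly 'F_p}) : (poly_embed q == 0) = (q == 0).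
Proof. by rewrite -(tofrac_eq0 q) -(fmorph_eq0 (in_alg K)). Qed.

Lemma transcendental_XsubC c : transcendental prime_embed (poly_embed ('X - c%:P)).
Proof.
move=> q; rewrite map_poly_embed => /eqP; rewrite poly_embed_eq0.
by rewrite comp_poly2_eq0 ?size_XsubC // => /eqP.
Qed.

Section DegreeOnePlace.
Variables (O : pred K) (c : 'F_p).
Hypotheses (HO : is_place O) (cM : in_maxO O (poly_embed ('X - c%:P))).

Lemma poly_embed_place q : poly_embed q \in O.
Proof.
have -> : poly_embed q = (map_poly prime_embed (q \Po ('X + c%:P))).[poly_embed ('X - c%:P)].
  rewrite map_poly_embed -comp_polyA comp_polyD comp_polyX comp_polyC subrK.
  by rewrite comp_polyXr.
rewrite horner_coef; apply: place_sum => // i _; apply: placeM => //.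
  by rewrite coef_map; exact: prime_embed_place.
by apply: placeX => //; exact: maxOW cM.
Qed.

Lemma poly_embed_residue q : in_maxO O (poly_embed q - prime_embed q.[c]).
Proof.
have [|r Er] := factor_theorem (q - q.[c]%:P) c _.
  by apply/rootP; rewrite !hornerE subrr.
rewrite -[prime_embed _]/(poly_embed q.[c]%:P) -rmorphB Er rmorphM.
by apply: maxOMl => //; exact: poly_embed_place.
Qed.

(** The residue field of F_p(t) at t = c is F_p. In a reduced fraction a/b, either b(c) is nonzero
    and the residue is a(c)/b(c), or a(c) is nonzero and the fraction has a pole. *)
Lemma rational_residue (z : FpT p) : in_alg K z \in O ->
  exists e, in_maxO O (in_alg K z - prime_embed e).
Proof.
have [a [b [b0 ab Ez]]] : exists a b : {poly 'F_p},
    [/\ b != 0, coprimep a b & z = tofrac a / tofrac b] := fraction_coprime z.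
have -> : in_alg K z = poly_embed a / poly_embed b by rewrite Ez fmorph_div.
move=> zO.
have B0 : poly_embed b != 0 by rewrite poly_embed_eq0.
have [bc|bc] := eqVneq b.[c] 0.
  have ac : a.[c] != 0.
    have ba : coprimep b a by rewrite coprimep_sym.
    by have := coprimep_root (x := c) ba; apply; apply/rootP.
  have bM : in_maxO O (poly_embed b).
    by have := poly_embed_residue b; rewrite bc rmorph0 subr0.
  have aM : in_maxO O (poly_embed a) by rewrite -(mulfVK B0 (poly_embed a)) maxOMl.
  have : in_maxO O (prime_embed a.[c]).
    have -> : prime_embed a.[c] = poly_embed a - (poly_embed a - prime_embed a.[c]) by ring.
    by apply: maxOB => //; exact: poly_embed_residue.
  by rewrite (iota_maxO prime_embed_place) // (negPf ac).
exists (a.[c] / b.[c]).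
have bU : unitO O (poly_embed b).
  apply: maxO_unit; first exact: poly_embed_place.
  apply/negP => bM; have : in_maxO O (prime_embed b.[c]).
    have -> : prime_embed b.[c] = poly_embed b - (poly_embed b - prime_embed b.[c]) by ring.
    by apply: maxOB => //; exact: poly_embed_residue.
  by rewrite (iota_maxO prime_embed_place) // (negPf bc).
have B1 : prime_embed b.[c] != 0 by rewrite fmorph_eq0.
rewrite fmorph_div.
have -> : poly_embed a / poly_embed b - prime_embed a.[c] / prime_embed b.[c] =
   ((poly_embed a - prime_embed a.[c]) -
    (poly_embed b - prime_embed b.[c]) * (prime_embed a.[c] / prime_embed b.[c])) *
    (poly_embed b)^-1 by field; rewrite B0 B1.
apply: maxOM => //; last by case/and3P: bU.
apply: maxOB => //; first exact: poly_embed_residue.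
apply: maxOM => //; first exact: poly_embed_residue.
by rewrite -fmorph_div; exact: prime_embed_place.
Qed.

Definition residually_free (k : nat) (u : nat -> K) : Prop :=
  (forall i, (i < k)%N -> u i \in O) /\
  forall e : nat -> 'F_p, in_maxO O (\sum_(i < k) prime_embed (e i) * u i) ->
    forall i, (i < k)%N -> e i = 0.

(** Residue degree is at most field degree: a relation over F_p(t), divided by its coefficient of
    least valuation, reduces to a nontrivial relation over F_p between the residues. *)
Lemma residually_free_dim k u : residually_free k u -> (k <= \dim {:K})%N.
Proof.
move=> [uO uP]; pose X := [tuple u i | i < k].
suff /eqP E : free X by rewrite -[k](size_tuple X) -E dimvS ?subvf.
apply/freeP => a Ea i; apply/eqP; apply: contraT => ai.
pose A j := in_alg K (a j).
have As : A i \in [seq A j | j : 'I_k] by apply: map_f; rewrite mem_enum.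
have Ai : A i != 0 by rewrite /A fmorph_eq0.
have [z [/mapP[j _ Ez] z0 zP]] := place_dominant HO As Ai.
have AO l : A l / z \in O by apply: zP; apply: map_f; rewrite mem_enum.
have /choice [e eP] : forall l, exists e, in_maxO O (A l / z - prime_embed e).
  move=> l; have := AO l; rewrite Ez /A -fmorph_div => /rational_residue [e eM].
  by exists e.
have S0 : \sum_(l < k) A l / z * u l = 0.
  under eq_bigr do rewrite mulrAC.
  rewrite -mulr_suml -[RHS](mul0r z^-1) -[in RHS]Ea; congr (_ * _).
  by apply: eq_bigr => l _; rewrite nth_mktuple /A /= mulr_algl.
pose e' n := if insub n is Some l then e l else 0.
have e'E l : e' (val l) = e l by rewrite /e' valK.
have ej : e j = 0.
  rewrite -e'E; apply: uP; last exact: ltn_ord.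
  have -> : \sum_(l < k) prime_embed (e' l) * u l =
      - (\sum_(l < k) (A l / z - prime_embed (e l)) * u l).
    rewrite -[LHS]opprK; congr (- _); rewrite -[LHS]add0r -{1}S0 -sumrB.
    by apply: eq_bigr => l _; rewrite -e'E mulrBl.
  apply: maxON => //; apply: maxO_sum => // l _.
  apply: maxOM => //; exact: uO.
by have := eP j; rewrite ej rmorph0 subr0 -Ez divff // maxO1.
Qed.

(** A maximal residually free family of size k lifts a basis of the residue field over F_p, so its
    p^k combinations represent all residues. *)
Lemma residue_card_bound : exists2 N, residue_card O N & (N <= p ^ \dim {:K})%N.
Proof.
pose Q k := `[< exists u, residually_free k u >].
have ex : exists k, Q k.
  by exists 0; apply/asboolP; exists (fun=> 0); split.
have bnd k : Q k -> (k <= \dim {:K})%N by move=> /asboolP [u]; exact: residually_free_dim.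
case: (ex_maxnP ex bnd) => k /asboolP [u [uO uP]] kmax.
exists (p ^ k)%N; last by rewrite leq_pexp2l ?prime_gt0 // bnd //; apply/asboolP; exists u.
pose S (e : {ffun 'I_k -> 'F_p}) := \sum_(i < k) prime_embed (e i) * u i.
have SE (e : nat -> 'F_p) : S [ffun i : 'I_k => e i] = \sum_(i < k) prime_embed (e i) * u i.
  by apply: eq_bigr => i _; rewrite ffunE.
exists [seq S e | e <- enum {: {ffun 'I_k -> 'F_p}}]; split.
- by rewrite size_map -cardE card_ffun card_Fp // card_ord.
- apply/allP => _ /mapP[e _ ->]; apply: place_sum => // i _; apply: placeM => //.
    exact: prime_embed_place.
  exact: uO.
- rewrite pairwise_map; have := enum_uniq {: {ffun 'I_k -> 'F_p}}; rewrite uniq_pairwise.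
  apply: sub_pairwise => e1 e2 /=; apply: contraNN => SM.
  pose e' n := if insub n is Some l then e1 l - e2 l else 0.
  have e'E l : e' (val l) = e1 l - e2 l by rewrite /e' valK.
  apply/eqP/ffunP => i; apply/eqP; rewrite -subr_eq0 -e'E; apply/eqP.
  apply: uP; last exact: ltn_ord.
  suff -> : \sum_(l < k) prime_embed (e' l) * u l = S e1 - S e2 by [].
  by rewrite /S -sumrB; apply: eq_bigr => l _; rewrite e'E rmorphB mulrBl.
(* Appending [x] breaks freeness. The coefficient of [x] in the resulting relation is nonzero
   because [u] is free, so the residue of [x] can be solved for. *)
move=> x xO; pose u' i := if (i < k)%N then u i else x.
have : ~ residually_free k.+1 u'.
  by move=> H; have /kmax : Q k.+1 by [apply/asboolP; exists u']; rewrite ltnn.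
move=> /not_andP [|/existsNP [e]].
  by case=> i _; rewrite /u'; case: ifP => // /uO.
move=> /not_implyP [eM /existsNP [j /not_implyP [jk ej]]].
have {}eM : in_maxO O (\sum_(i < k) prime_embed (e i) * u i + prime_embed (e k) * x).
  move: eM; rewrite big_ord_recr {2}/u' ltnn; congr (in_maxO O (_ + _)).
  by apply: eq_bigr => i _; rewrite /u' (ltn_ord i : (widen_ord (leqnSn k) i < k)%N).
have ek : e k != 0.
  apply/eqP => ek0; have E0 : prime_embed (e k) = 0 by rewrite ek0 rmorph0.
  rewrite E0 mul0r addr0 in eM.
  by apply: ej; move: jk; rewrite ltnS leq_eqVlt => /predU1P[->|] //; exact: uP.
have Ek : prime_embed (e k) != 0 by rewrite fmorph_eq0.
exists (S [ffun i : 'I_k => - e i / e k]); first by apply: map_f; rewrite mem_enum.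
have -> : x - S [ffun i : 'I_k => - e i / e k] =
    (\sum_(i < k) prime_embed (e i) * u i + prime_embed (e k) * x) * prime_embed (e k)^-1.
  rewrite (SE (fun i => - e i / e k)) mulrDl addrC fmorphV [_ * x]mulrC mulfK //.
  congr (_ + _); rewrite -sumrN mulr_suml; apply: eq_bigr => i _.
  by rewrite mulNr rmorphN fmorph_div mulNr opprK mulrAC.
by apply: maxOM => //; exact: prime_embed_place.
Qed.

End DegreeOnePlace.

(** The elements t and t - 1 differ by 1, so no maximal ideal contains both; the places above t = 0
    and t = 1 are therefore distinct and cannot both be bad. *)
Lemma good_degree_one_place (good : pred K -> Prop) (O0 : pred K) :
    (forall O, is_place O -> ~ good O -> O =i O0) ->
  exists O : pred K, [/\ is_place O, good O
    & exists2 N, residue_card O N & (N <= p ^ \dim {:K})%N].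
Proof.
move=> bad.
have [O1 HO1 [_ M1]] := place_above (@transcendental_XsubC 0).
have [O2 HO2 [_ M2]] := place_above (@transcendental_XsubC 1).
have [g1|b1] := pselect (good O1).
  by exists O1; split=> //; exact: residue_card_bound M1.
have [g2|b2] := pselect (good O2).
  by exists O2; split=> //; exact: residue_card_bound M2.
have E : O1 =i O2 by move=> x; rewrite (bad O1) ?(bad O2).
have M2' : in_maxO O1 (poly_embed ('X - 1%:P)).
  by move: M2; rewrite !maxOE !E.
have := maxOB HO1 M1 M2'; rewrite -rmorphB.
have -> : 'X - 0%:P - ('X - 1%:P) = 1 :> {poly 'F_p} by rewrite polyC0 polyC1; ring.
by rewrite rmorph1 maxO1.
Qed.

End FunctionField.

(** * Periodicity of the orbit and the final count *)

Theorem theorem6p6 (p : nat) (hp : prime p) (K : fieldExtType (FpT p))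
  (d : nat) (f g : {poly K})
  (hf : hom_form d f) (hg : hom_form d g) (hcop : hom_coprime d f g)
  (hbad : exists O0 : pred K,
      [/\ is_place O0, ~ good_reduction O0 d f g &
          forall O : pred K, is_place O -> ~ good_reduction O d f g ->
            O =i O0])
  (P : option K) (A : seq (option K)) (hA : uniq A)
  (horb : forall Q, Q \in A <-> exists i : nat, iter i (ratmap d f g) P = Q) :
  (forall (O : pred K) (N : nat), is_place O -> good_reduction O d f g ->
      residue_card O N -> (size A <= 3 * N + 6)%N)
  /\ (size A <= 3 * p ^ (\dim {: K}) + 6)%N.
Proof.
case: hbad => O0 [_ _ bad].
pose good O := good_reduction O d f g; pose phi := ratmap d f g.
have nc (O : pred K) : is_place O -> good O -> noncontracting O phi.
  by move=> HO gO; exact: good_reduction_noncontracting.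
have [m [n [n0 per mini]]] : exists m n, [/\ (0 < n)%N, orb phi P (m + n) = orb phi P m
    & forall u, (0 < u < n)%N -> orb phi P (m + u) <> orb phi P m].
  have [i [k [k0 Ek]]] : exists i k, (0 < k)%N /\ orb phi P (i + k) = orb phi P i.
    apply: contrapT => H.
    (* Without a repetition the first #A + 1 orbit points would be distinct members of [A]. *)
    suff : (size [seq orb phi P i | i <- iota 0 (size A).+1] <= size A)%N.
      by rewrite size_map size_iota ltnn.
    apply: uniq_leq_size; last by move=> _ /mapP[i _ ->]; apply/horb; exists i.
    rewrite map_inj_uniq ?iota_uniq // => i j Eij; apply/eqP; apply: contraT => ij.
    case: H; case: (ltngtP i j) ij => // ij _.
      by exists i, (j - i)%N; rewrite subn_gt0 ij subnKC // ltnW.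
    by exists j, (i - j)%N; rewrite subn_gt0 ij subnKC // ltnW.
  (* The period is minimized over all starting indices at once, so no shorter one occurs at the
     chosen index. *)
  have ex : exists k, (0 < k)%N && (orb phi P (i + k) == orb phi P i).
    by exists k; rewrite k0 Ek eqxx.
  case: (ex_minnP ex) => n /andP[n0 /eqP En] nmin.
  exists i, n; split=> // u /andP[u0 un] /eqP Eu.
  by have := nmin u; rewrite u0 Eu leqNgt un => /(_ isT).
have sA Q : Q \in A -> exists i, Q = orb phi P i.
  by move=> /horb [i <-]; exists i.
have bound (O : pred K) N : is_place O -> residue_card O N -> (size A <= N.+1 + N.+1)%N.
  move=> HO HN.
  have [n24|] := boolP (odd n || (4 %| n)%N).
    apply: leq_trans (leq_addr _ _).
    exact: (orbit_card (@prime_embed_place p K) bad nc HO HN n0 per mini n24 hA sA).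
  rewrite negb_or => /andP[on n4].
  have orb2 e i : orb (iter 2 phi) (orb phi P e) i = orb phi P (i * 2 + e).
    by rewrite /orb iterD iterM.
  have half e (s : seq (option K)) : uniq s ->
      (forall Q, Q \in s -> exists i, Q = orb phi P (i * 2 + e)) -> (size s <= N.+1)%N.
    move=> us sorb.
    have [h En] : exists h, n = (h * 2)%N by apply/dvdnP; rewrite dvdn2.
    have orbD k i j : orb phi P i = orb phi P j -> orb phi P (k + i) = orb phi P (k + j).
      by rewrite /orb !iterD => ->.
    have nc2 (O' : pred K) : is_place O' -> good O' -> noncontracting O' (iter 2 phi).
      by move=> HO' gO'; apply: noncontracting_iter => //; exact: nc.
    (* Index m of the half-orbit is index 2m + e of the orbit, already on the cycle; the second
       iterate has cycle length h = n/2 there, odd because 4 does not divide n. *)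
    apply: (orbit_card (@prime_embed_place p K) bad nc2 (P0 := orb phi P e) HO HN
      (m := m) (n := h)) => //.
    - by move: n0; rewrite En; case: (h).
    - rewrite !orb2; have -> : ((m + h) * 2 + e = (m + e) + (m + n))%N by rewrite En; lia.
      by rewrite (orbD _ _ _ per); congr (orb phi P _); lia.
    - move=> u /andP[u0 uh]; rewrite !orb2.
      have nu : ~~ (n %| u * 2)%N by rewrite gtnNdvd; lia.
      have := cyc_neq n0 per mini (i := (m + e)%N) nu; rewrite /cyc => neq E; apply: neq.
      have -> : (m + (m + e) = m * 2 + e)%N by lia.
      by rewrite -E; congr (orb phi P _); lia.
    - apply/orP; left; apply: contraT => oh; case/negP: n4.
      rewrite En (_ : 4 = 2 * 2)%N // dvdn_pmul2r // dvdn2 //.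
    - by move=> Q /sorb [i ->]; exists i; rewrite orb2.
  pose ev Q := `[< exists i, Q = orb phi P (i * 2) >].
  rewrite -(count_predC ev A) -!size_filter; apply: leq_add.
    apply: (half 0); first exact: filter_uniq.
    move=> Q; rewrite mem_filter => /andP[/asboolP [i ->] _].
    by exists i; rewrite addn0.
  apply: (half 1); first exact: filter_uniq.
  move=> Q; rewrite mem_filter => /andP[/asboolP nev /sA [i Ei]].
  exists (i %/ 2)%N; rewrite Ei; congr (orb phi P _).
  rewrite {1}(divn_eq i 2) modn2; case oi: (odd i) => //.
  by case: nev; exists (i %/ 2)%N; rewrite Ei {1}(divn_eq i 2) modn2 oi addn0.
split=> [O N HO gO HN|]; first by have := bound O N HO HN; lia.
have [O [HO gO [N HN leN]]] := good_degree_one_place hp bad.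
by have := bound O N HO HN; lia.
Qed.
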